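(* The following is provable in $\mathbf{ZF}$. Suppose that $\mathbf{X}$ is a topological space which is not pseudocompact. Then $\mathbf{X}$ admits a locally finite denumerable cellular family, so $\mathbf{X}$ satisfies none of the following conditions: $(B_1)$ every countable open cover $\mathcal{U}$ of $\mathbf{X}$ has a finite subcollection $\mathcal{V}$ such that $X=\bigcup\{\overline{U}: U\in\mathcal{V}\}$; $(B_2)$ every denumerable family of non-empty open subsets of $\mathbf{X}$ has a cluster point in $\mathbf{X}$; $(B_3)$ every denumerable cellular family of $\mathbf{X}$ has a cluster point in $\mathbf{X}$; $(B_4)$ every countable filter base consisting of open sets of $\mathbf{X}$ has a point of adherence; $(B_5)$ every countable, locally finite, disjoint collection of open sets of $\mathbf{X}$ is finite.
   Context: The base theory is $\mathbf{ZF}$, with no form of the axiom of choice assumed. A set is denumerable if it is equipotent with $\omega$, and countable if it is equipotent with a subset of $\omega$. A space is pseudocompact if every continuous real-valued function on it is bounded. A family of subsets is locally finite if every point has a neighborhood meeting only finitely many members of it. A cellular family is a set of pairwise disjoint non-empty open sets. A cluster point of an infinite family $\mathcal{F}$ of non-empty subsets is a point $x$ such that every neighborhood of $x$ meets infinitely many members of $\mathcal{F}$. A filter base is a collection $\mathcal{F}$ of non-empty sets such that for all $A,B\in\mathcal{F}$ there is $C\in\mathcal{F}$ with $C\subseteq A\cap B$; a point of adherence of $\mathcal{F}$ is an element of $\bigcap\{\overline{A}:A\in\mathcal{F}\}$. (Conditions $(B_1)$-$(B_5)$ are known to be equivalent in $\mathbf{ZF}$ for every topological space.) *)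

(* Defs.v *)
From Stdlib Require List.
From mathcomp Require Import all_boot.

Set Implicit Arguments.
Unset Strict Implicit.
Unset Printing Implicit Defensive.

(** * First-order logic with equality over the language {∈}

    "Provable in ZF" is rendered literally, as derivability from the axioms of
    ZF in classical natural deduction: the logic of Rocq (and any choice axiom
    assumed there) does not leak into what the object theory can prove. *)

(* De Bruijn indices; the only terms are variables. *)
Inductive form : Type :=
| Bot
| Eq  of nat & nat
| Elem of nat & nat
| Imp of form & form
| And of form & form
| Or  of form & form
| All of form
| Ex  of form.

Definition up (r : nat -> nat) (i : nat) : nat :=
  if i is j.+1 then (r j).+1 else 0.

Fixpoint ren (r : nat -> nat) (A : form) : form :=
  match A with
  | Bot => Bot
  | Eq i j => Eq (r i) (r j)
  | Elem i j => Elem (r i) (r j)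
  | Imp A B => Imp (ren r A) (ren r B)
  | And A B => And (ren r A) (ren r B)
  | Or A B => Or (ren r A) (ren r B)
  | All A => All (ren (up r) A)
  | Ex A => Ex (ren (up r) A)
  end.

Definition shift : form -> form := ren S.

(* A[t], where t replaces variable 0 and the other variables move down. *)
Definition inst (t : nat) : form -> form :=
  ren (fun i => if i is j.+1 then j else t).

Section NaturalDeduction.

Reserved Notation "G |-- A" (at level 71).

Inductive derives : seq form -> form -> Prop :=
| ND_hyp G A : List.In A G -> G |-- A
| ND_raa G A : Imp A Bot :: G |-- Bot -> G |-- A
| ND_impI G A B : A :: G |-- B -> G |-- Imp A B
| ND_impE G A B : G |-- Imp A B -> G |-- A -> G |-- B
| ND_andI G A B : G |-- A -> G |-- B -> G |-- And A B
| ND_andE1 G A B : G |-- And A B -> G |-- A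
| ND_andE2 G A B : G |-- And A B -> G |-- B
| ND_orI1 G A B : G |-- A -> G |-- Or A B
| ND_orI2 G A B : G |-- B -> G |-- Or A B
| ND_orE G A B C : G |-- Or A B -> A :: G |-- C -> B :: G |-- C -> G |-- C
| ND_allI G A : map shift G |-- A -> G |-- All A
| ND_allE G A t : G |-- All A -> G |-- inst t A
| ND_exI G A t : G |-- inst t A -> G |-- Ex A
| ND_exE G A C : G |-- Ex A -> A :: map shift G |-- shift C -> G |-- C
| ND_eqI G t : G |-- Eq t t
| ND_eqE G A s t : G |-- Eq s t -> G |-- inst s A -> G |-- inst t A
where "G |-- A" := (derives G A).

End NaturalDeduction.

Definition provable (T : form -> Prop) (A : form) : Prop :=
  exists G : seq form, (forall B, List.In B G -> T B) /\ derives G A.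

(* All free variables of A are below fv_bound A. *)
Fixpoint fv_bound (A : form) : nat :=
  match A with
  | Bot => 0
  | Eq i j | Elem i j => maxn i.+1 j.+1
  | Imp A B | And A B | Or A B => maxn (fv_bound A) (fv_bound B)
  | All A | Ex A => (fv_bound A).-1
  end.

Definition univ_closure (A : form) : form := iter (fv_bound A) All A.

(** * Named binders

    A [pform] is a formula waiting for the number d of quantifiers above it.
    A bound variable is represented by its level (the number of quantifiers
    above its own binder); under d quantifiers, level l is the index d - l.+1.
    This lets Rocq binders name the variables of the object language.  Levels
    are meant to be introduced only by [pAll] and [pEx]. *)

Definition pform : Type := nat -> form.
Definition var : Type := nat.

Definition pBot : pform := fun=> Bot.
Definition pEq (x y : var) : pform := fun d => Eq (d - x.+1) (d - y.+1).
Definition pIn (x y : var) : pform := fun d => Elem (d - x.+1) (d - y.+1).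
Definition pImp (p q : pform) : pform := fun d => Imp (p d) (q d).
Definition pAnd (p q : pform) : pform := fun d => And (p d) (q d).
Definition pOr (p q : pform) : pform := fun d => Or (p d) (q d).
Definition pNot (p : pform) : pform := pImp p pBot.
Definition pIff (p q : pform) : pform := pAnd (pImp p q) (pImp q p).
Definition pAll (f : var -> pform) : pform := fun d => All (f d d.+1).
Definition pEx (f : var -> pform) : pform := fun d => Ex (f d d.+1).

(* The first variables of A are replaced by those listed in s; the remaining
   ones are parameters, free in the result. *)
Definition pApp (A : form) (s : seq var) : pform := fun d =>
  ren (fun i => if i < size s then d - (nth 0 s i).+1 else d + (i - size s)) A.

Definition sentence (p : pform) : form := p 0.

Declare Scope zf_scope.
Delimit Scope zf_scope with zf.
Bind Scope zf_scope with pform.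

Notation "x ≡ y" := (pEq x y) (at level 70, no associativity) : zf_scope.
Notation "x ∈ y" := (pIn x y) (at level 70, no associativity) : zf_scope.
Notation "¬ p" := (pNot p) (at level 75, right associativity) : zf_scope.
Notation "p ∧ q" := (pAnd p q) (at level 80, right associativity) : zf_scope.
Notation "p ∨ q" := (pOr p q) (at level 85, right associativity) : zf_scope.
Notation "p ⇔ q" := (pIff p q) (at level 95, no associativity) : zf_scope.
Notation "p ⇒ q" := (pImp p q) (at level 99, right associativity) : zf_scope.
Notation "∀ x , p" := (pAll (fun x => p))
  (at level 10, x name, p at level 200, right associativity) : zf_scope.
Notation "∃ x , p" := (pEx (fun x => p))
  (at level 10, x name, p at level 200, right associativity) : zf_scope.
Notation "∀ x ∈ a , p" := (pAll (fun x => pImp (pIn x a) p))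
  (at level 10, x name, a at level 60, p at level 200, right associativity)
  : zf_scope.
Notation "∃ x ∈ a , p" := (pEx (fun x => pAnd (pIn x a) p))
  (at level 10, x name, a at level 60, p at level 200, right associativity)
  : zf_scope.

Local Open Scope zf_scope.

Definition sub (a b : var) : pform := ∀ x ∈ a, x ∈ b.
Definition is_empty (a : var) : pform := ∀ x, ¬ x ∈ a.
Definition nonempty (a : var) : pform := ∃ x, x ∈ a.
Definition meets (a b : var) : pform := ∃ x, x ∈ a ∧ x ∈ b.

Definition is_inter (c a b : var) : pform := ∀ x, x ∈ c ⇔ x ∈ a ∧ x ∈ b.
Definition is_union (u s : var) : pform := ∀ x, x ∈ u ⇔ ∃ a ∈ s, x ∈ a.
Definition is_diff (c a b : var) : pform := ∀ x, x ∈ c ⇔ x ∈ a ∧ ¬ x ∈ b.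
Definition is_pair (p a b : var) : pform := ∀ x, x ∈ p ⇔ x ≡ a ∨ x ≡ b.
Definition is_succ (y x : var) : pform := ∀ z, z ∈ y ⇔ z ∈ x ∨ z ≡ x.

(* Kuratowski: (a, b) = {{a}, {a, b}} *)
Definition is_opair (p a b : var) : pform :=
  ∃ s, ∃ t, is_pair s a a ∧ is_pair t a b ∧ is_pair p s t.

(* (a, b) ∈ r *)
Definition opair_in (a b r : var) : pform := ∃ p, is_opair p a b ∧ p ∈ r.

Definition is_prod (c a b : var) : pform :=
  ∀ p, p ∈ c ⇔ ∃ x ∈ a, ∃ y ∈ b, is_opair p x y.

Definition is_rel (r a b : var) : pform :=
  ∀ p ∈ r, ∃ x ∈ a, ∃ y ∈ b, is_opair p x y.

Definition is_fun (f a b : var) : pform :=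
  is_rel f a b ∧
  ∀ x ∈ a, ∃ y, opair_in x y f ∧ ∀ z, opair_in x z f ⇒ z ≡ y.

Definition is_bij (f a b : var) : pform :=
  is_fun f a b ∧
  (∀ x, ∀ y, ∀ z, opair_in x z f ∧ opair_in y z f ⇒ x ≡ y) ∧
  ∀ y ∈ b, ∃ x, opair_in x y f.

Definition equipotent (a b : var) : pform := ∃ f, is_bij f a b.

Definition inductive (w : var) : pform :=
  (∃ e ∈ w, is_empty e) ∧ ∀ x ∈ w, ∃ y ∈ w, is_succ y x.

Definition is_omega (w : var) : pform :=
  inductive w ∧ ∀ v, inductive v ⇒ sub w v.

Definition finite (a : var) : pform :=
  ∃ w, is_omega w ∧ ∃ n ∈ w, equipotent a n.
Definition denumerable (a : var) : pform :=
  ∃ w, is_omega w ∧ equipotent a w.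
Definition countable (a : var) : pform :=
  ∃ w, is_omega w ∧ ∃ s, sub s w ∧ equipotent a s.

Definition ax_extensionality : pform :=
  ∀ a, ∀ b, (∀ x, x ∈ a ⇔ x ∈ b) ⇒ a ≡ b.
Definition ax_foundation : pform :=
  ∀ a, nonempty a ⇒ ∃ x ∈ a, ¬ meets x a.
Definition ax_pairing : pform := ∀ a, ∀ b, ∃ p, is_pair p a b.
Definition ax_union : pform := ∀ s, ∃ u, is_union u s.
Definition ax_power : pform := ∀ a, ∃ p, ∀ x, x ∈ p ⇔ sub x a.
Definition ax_infinity : pform := ∃ w, inductive w.

(* The parameters of the formula A are universally quantified by [univ_closure]. *)
Definition ax_separation (A : form) : form :=
  univ_closure (sentence
    (∀ a, ∃ b, ∀ x, x ∈ b ⇔ x ∈ a ∧ pApp A [:: x])).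
Definition ax_replacement (A : form) : form :=
  univ_closure (sentence
    (∀ a, (∀ x ∈ a, ∀ y, ∀ z, pApp A [:: x; y] ∧ pApp A [:: x; z] ⇒ y ≡ z) ⇒
          ∃ b, ∀ y, y ∈ b ⇔ ∃ x ∈ a, pApp A [:: x; y])).

Inductive ZF : form -> Prop :=
| ZF_extensionality : ZF (sentence ax_extensionality)
| ZF_foundation : ZF (sentence ax_foundation)
| ZF_pairing : ZF (sentence ax_pairing)
| ZF_union : ZF (sentence ax_union)
| ZF_power : ZF (sentence ax_power)
| ZF_infinity : ZF (sentence ax_infinity)
| ZF_separation A : ZF (ax_separation A)
| ZF_replacement A : ZF (ax_replacement A).

(* The real line is characterized as a Dedekind-complete ordered field (ZF
   proves that there is one and that it is unique up to isomorphism).  The sets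
   add, mul and lt are the graphs of the operations and of the strict order. *)

Definition is_binop (f r : var) : pform := ∃ c, is_prod c r r ∧ is_fun f c r.

(* f(x, y) = z *)
Definition op (f x y z : var) : pform := ∃ p, is_opair p x y ∧ opair_in p z f.

Definition op_comm (f : var) : pform :=
  ∀ x, ∀ y, ∀ z, op f x y z ⇒ op f y x z.
Definition op_assoc (f : var) : pform :=
  ∀ x, ∀ y, ∀ z, ∀ xy, ∀ yz, ∀ t,
    op f x y xy ∧ op f y z yz ∧ op f xy z t ⇒ op f x yz t.
Definition op_unit (r f e : var) : pform := e ∈ r ∧ ∀ x ∈ r, op f x e x.

Definition is_field (r add mul zero one : var) : pform :=
  is_binop add r ∧ op_assoc add ∧ op_comm add ∧ op_unit r add zero ∧
  (∀ x ∈ r, ∃ y ∈ r, op add x y zero) ∧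
  is_binop mul r ∧ op_assoc mul ∧ op_comm mul ∧ op_unit r mul one ∧
  (∀ x ∈ r, ¬ x ≡ zero ⇒ ∃ y ∈ r, op mul x y one) ∧
  ¬ zero ≡ one ∧
  (∀ x, ∀ y, ∀ z, ∀ yz, ∀ xy, ∀ xz, ∀ t,
     op add y z yz ∧ op mul x yz t ∧ op mul x y xy ∧ op mul x z xz ⇒
     op add xy xz t).

Definition is_strict_total_order (r lt : var) : pform :=
  is_rel lt r r ∧
  (∀ x, ¬ opair_in x x lt) ∧
  (∀ x, ∀ y, ∀ z, opair_in x y lt ∧ opair_in y z lt ⇒ opair_in x z lt) ∧
  (∀ x ∈ r, ∀ y ∈ r, opair_in x y lt ∨ x ≡ y ∨ opair_in y x lt).

Definition le_in (lt x y : var) : pform := opair_in x y lt ∨ x ≡ y.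

Definition is_upper_bound (lt s b : var) : pform := ∀ x ∈ s, le_in lt x b.

Definition dedekind_complete (r lt : var) : pform :=
  ∀ s, sub s r ∧ nonempty s ∧ (∃ b ∈ r, is_upper_bound lt s b) ⇒
    ∃ b ∈ r, is_upper_bound lt s b ∧
             ∀ c ∈ r, is_upper_bound lt s c ⇒ le_in lt b c.

Definition is_reals (r add mul zero one lt : var) : pform :=
  is_field r add mul zero one ∧
  is_strict_total_order r lt ∧
  (∀ x, ∀ y, ∀ z, ∀ xz, ∀ yz,
     opair_in x y lt ∧ op add x z xz ∧ op add y z yz ⇒ opair_in xz yz lt) ∧
  (∀ x, ∀ y, ∀ xy,
     opair_in zero x lt ∧ opair_in zero y lt ∧ op mul x y xy ⇒
     opair_in zero xy lt) ∧
  dedekind_complete r lt.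

(* The standard topology of the line: each point of u lies in an open interval
   contained in u. *)
Definition open_in_reals (r lt u : var) : pform :=
  sub u r ∧
  ∀ y ∈ u, ∃ a, ∃ b, opair_in a y lt ∧ opair_in y b lt ∧
    ∀ z, opair_in a z lt ∧ opair_in z b lt ⇒ z ∈ u.

(* A topological space is a pair (X, T), where T is the set of open sets. *)

Definition is_topology (X T : var) : pform :=
  (∀ U ∈ T, sub U X) ∧
  (∃ U ∈ T, is_empty U) ∧ X ∈ T ∧
  (∀ U ∈ T, ∀ V ∈ T, ∃ W ∈ T, is_inter W U V) ∧
  (∀ D, sub D T ⇒ ∃ W ∈ T, is_union W D).

Definition is_nbhd (X T N x : var) : pform :=
  sub N X ∧ ∃ U ∈ T, x ∈ U ∧ sub U N.

Definition is_closed (X T C : var) : pform :=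
  sub C X ∧ ∃ U ∈ T, is_diff U X C.

Definition in_closure (X T A x : var) : pform :=
  x ∈ X ∧ ∀ C, is_closed X T C ∧ sub A C ⇒ x ∈ C.

(* G = {A ∈ F : A ∩ N ≠ ∅} *)
Definition is_trace (G F N : var) : pform :=
  ∀ A, A ∈ G ⇔ A ∈ F ∧ meets A N.

Definition locally_finite (X T F : var) : pform :=
  ∀ x ∈ X, ∃ N, is_nbhd X T N x ∧ ∃ G, is_trace G F N ∧ finite G.

Definition pairwise_disjoint (F : var) : pform :=
  ∀ A ∈ F, ∀ B ∈ F, ¬ A ≡ B ⇒ ¬ meets A B.

Definition nonempty_members (F : var) : pform := ∀ A ∈ F, nonempty A.

Definition cellular (T F : var) : pform :=
  sub F T ∧ nonempty_members F ∧ pairwise_disjoint F.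

Definition cluster_point (X T F x : var) : pform :=
  x ∈ X ∧ ∀ N, is_nbhd X T N x ⇒ ∃ G, is_trace G F N ∧ ¬ finite G.

Definition is_cover (X F : var) : pform := is_union X F.

(* There is no non-emptiness clause: the empty
   collection is a filter base; all points of X adhere to it. *)
Definition filter_base (X F : var) : pform :=
  (∀ A ∈ F, sub A X) ∧ nonempty_members F ∧
  ∀ A ∈ F, ∀ B ∈ F, ∃ C ∈ F, ∀ x ∈ C, x ∈ A ∧ x ∈ B.

Definition adherence_point (X T F x : var) : pform :=
  x ∈ X ∧ ∀ A ∈ F, in_closure X T A x.

Definition continuous_to_reals (X T r lt f : var) : pform :=
  is_fun f X r ∧
  ∀ V, open_in_reals r lt V ⇒
    ∃ U ∈ T, ∀ x, x ∈ U ⇔ ∃ y ∈ V, opair_in x y f.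

Definition bounded_fun (r lt f : var) : pform :=
  ∃ a ∈ r, ∃ b ∈ r, ∀ x, ∀ y, opair_in x y f ⇒ le_in lt a y ∧ le_in lt y b.

Definition pseudocompact (X T : var) : pform :=
  ∀ r, ∀ add, ∀ mul, ∀ zero, ∀ one, ∀ lt, is_reals r add mul zero one lt ⇒
  ∀ f, continuous_to_reals X T r lt f ⇒ bounded_fun r lt f.

Definition B1 (X T : var) : pform :=
  ∀ U, countable U ∧ sub U T ∧ is_cover X U ⇒
    ∃ V, sub V U ∧ finite V ∧
      ∀ x, x ∈ X ⇔ ∃ A ∈ V, in_closure X T A x.

Definition B2 (X T : var) : pform :=
  ∀ F, denumerable F ∧ sub F T ∧ nonempty_members F ⇒
    ∃ x, cluster_point X T F x.

Definition B3 (X T : var) : pform :=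
  ∀ F, denumerable F ∧ cellular T F ⇒ ∃ x, cluster_point X T F x.

Definition B4 (X T : var) : pform :=
  ∀ F, countable F ∧ sub F T ∧ filter_base X F ⇒
    ∃ x, adherence_point X T F x.

Definition B5 (X T : var) : pform :=
  ∀ F, countable F ∧ sub F T ∧ locally_finite X T F ∧ pairwise_disjoint F ⇒
    finite F.

(* Main.v *)
(** Derivability in ZF is reduced to truth in all models by Gödel's completeness
    theorem, so the argument takes place inside an arbitrary model (M, E) of ZF,
    where separation and replacement are available for definable predicates
    only, and choice only for uniquely determined sets.

    Let f be an unbounded continuous function, say unbounded above (the other
    case is the same for the reversed order, with q negative).  For q > 0 put
    s(x) = x + 2q, and let D_0 and D_q be the closures of {0} and {q} under s.
    The sets f^-1((d, s(d))) with d in D_c are pairwise disjoint open sets and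
    form a locally finite family.  If for both c only finitely many of them were
    non-empty, all large values of f would lie in both D_0 and D_q, which are
    disjoint.  For one c there are thus infinitely many, indexed by a subset of
    D_c, in which every element has finitely many predecessors; counting the
    predecessors enumerates it without choice.

    A locally finite cellular family (F_n) refutes (B2), (B3) and (B5)
    directly.  The tails, the unions of F_m for m >= n, refute (B4); the interiors
    of the complements of the tails refute (B1). *)

From Stdlib Require Import Classical ClassicalEpsilon FunctionalExtensionality PropExtensionality.
From mathcomp Require Import all_boot.
Require Import Defs.

Set Implicit Arguments.
Unset Strict Implicit.
Unset Printing Implicit Defensive.

(** The intervals must be open for their preimages to be open, and disjoint for the family to be
    cellular, so the division points are left out and an unbounded [f] might take its large values
    only there. This is why two subdivisions are used: a start shifted by half a step puts the
    division points of one inside the gaps of the other. The step is a translation, and no sequence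
    of integers is mapped into the line: the closure of a point under the translation is an
    intersection of sets, so no recursion is involved. That this closure is unbounded comes from
    completeness, and that its initial segments are finite comes from induction over it. Stated for
    an abstract complete order with an increasing, invertible translation, the argument serves both
    directions of unboundedness. *)

Definition scons (T : Type) (x : T) (r : nat -> T) (i : nat) : T :=
  if i is j.+1 then r j else x.

(** * Renaming and derivability *)

Lemma ren_fv A r s :
  (forall i, i < fv_bound A -> r i = s i) -> ren r A = ren s A.
Proof.
elim: A r s => [|i j|i j|A IHA B IHB|A IHA B IHB|A IHA B IHB|A IHA|A IHA] r s //= rs;
  try (by rewrite !rs // leq_max leqnn ?orbT);
  try (by rewrite (IHA r s) ?(IHB r s) // => i ltiA; apply: rs;
          rewrite leq_max ltiA ?orbT).
all: rewrite (IHA (up r) (up s)) // => -[|i] //= ltiA; congr S; apply: rs.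
all: by rewrite -ltnS (ltn_predK ltiA).
Qed.

Lemma ren_ext A r s : (forall i, r i = s i) -> ren r A = ren s A.
Proof. by move=> rs; apply: ren_fv => i _; apply: rs. Qed.

Lemma ren_ren A r s : ren r (ren s A) = ren (fun i => r (s i)) A.
Proof.
elim: A r s => [|i j|i j|A IHA B IHB|A IHA B IHB|A IHA B IHB|A IHA|A IHA] r s //=;
  rewrite ?IHA ?IHB //; by congr (_ _); apply: ren_ext => -[].
Qed.

Lemma ren_id A : ren id A = A.
Proof.
elim: A => //= [A -> B ->|A -> B ->|A -> B ->|A IHA|A IHA] //;
  by congr (_ _); rewrite -[RHS]IHA; apply: ren_ext => -[].
Qed.

Lemma ren_closed A r : fv_bound A = 0 -> ren r A = A.
Proof. by move=> A0; rewrite -[RHS]ren_id; apply: ren_fv => i; rewrite A0. Qed.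

Lemma ren_inst A t r : ren r (inst t A) = inst (r t) (ren (up r) A).
Proof. by rewrite /inst !ren_ren; apply: ren_ext => -[]. Qed.

Lemma ren_shift A r : ren (up r) (shift A) = shift (ren r A).
Proof. by rewrite /shift !ren_ren. Qed.

Lemma fv_bound_ren A r m :
  (forall i, i < fv_bound A -> r i < m) -> fv_bound (ren r A) <= m.
Proof.
elim: A r m => [|i j|i j|A IHA B IHB|A IHA B IHB|A IHA B IHB|A IHA|A IHA] r m //= rm;
  rewrite ?geq_max;
  try (by rewrite !rm // leq_max leqnn ?orbT);
  try (by rewrite IHA ?IHB // => i ltiA; apply: rm; rewrite leq_max ltiA ?orbT).
all: rewrite -subn1 leq_subLR add1n; apply: IHA => -[|i] //= ltiA; rewrite ltnS; apply: rm.
all: by rewrite -ltnS (ltn_predK ltiA).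
Qed.

Lemma derives_weak G A G' : derives G A -> List.incl G G' -> derives G' A.
Proof.
have cons_incl (C : form) (G1 G2 : seq form) :
    List.incl G1 G2 -> List.incl (C :: G1) (C :: G2).
  by move=> s12 B [->|/s12 GB]; [left | right].
move=> der; elim: {G A}der G'; intros.
- exact/ND_hyp/H0.
- exact/ND_raa/H0/cons_incl.
- exact/ND_impI/H0/cons_incl.
- exact: ND_impE (H0 _ H3) (H2 _ H3).
- exact: ND_andI (H0 _ H3) (H2 _ H3).
- exact: ND_andE1 (H0 _ H1).
- exact: ND_andE2 (H0 _ H1).
- exact/ND_orI1/H0.
- exact/ND_orI2/H0.
- by apply: ND_orE (H0 _ H5) (H2 _ _) (H4 _ _); apply: cons_incl.
- exact/ND_allI/H0/List.incl_map.
- exact/ND_allE/H0.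
- exact: ND_exI (H0 _ H1).
- exact: ND_exE (H0 _ H3) (H2 _ (cons_incl _ _ _ (List.incl_map _ H3))).
- exact: ND_eqI.
- exact: ND_eqE (H0 _ H3) (H2 _ H3).
Qed.

Lemma derives_ren G A r : derives G A -> derives (map (ren r) G) (ren r A).
Proof.
have shiftE r0 G0 : map (ren (up r0)) (map shift G0) = map shift (map (ren r0) G0).
  by rewrite -!map_comp; apply: eq_map => B /=; rewrite ren_shift.
move=> der; elim: {G A}der r => /=; intros; rewrite ?ren_inst.
- exact/ND_hyp/List.in_map.
- exact/ND_raa/H0.
- exact/ND_impI/H0.
- exact: ND_impE (H0 r) (H2 r).
- exact: ND_andI (H0 r) (H2 r).
- exact: ND_andE1 (H0 r).
- exact: ND_andE2 (H0 r).
- exact/ND_orI1/H0.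
- exact/ND_orI2/H0.
- exact: ND_orE (H0 r) (H2 r) (H4 r).
- by apply/ND_allI; rewrite -shiftE; apply: H0.
- exact/ND_allE/H0.
- by apply: (@ND_exI _ _ (r t)); rewrite -ren_inst; apply: H0.
- by apply: ND_exE (H0 r) _; rewrite -shiftE -ren_shift; apply: H2.
- exact: ND_eqI.
- by apply: ND_eqE (H0 r) _; rewrite -ren_inst; apply: H2.
Qed.

(** A variable [k] that is free neither in [G] nor in [All A] serves as eigenvariable. Henkin
    constants will be such variables, the language having no constants. *)
Lemma derives_gen G A k :
  (forall B, List.In B G -> fv_bound B <= k) -> fv_bound A <= k.+1 ->
  derives G (inst k A) -> derives G (All A).
Proof.
move=> leGk leAk der; apply: ND_allI.
(* [r] sends [k] to the variable about to be bound and shifts the others; this undoes [inst k] on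
   [A] and acts as [shift] on [G]. *)
pose r i := if i == k then 0 else i.+1.
have := derives_ren r der.
have -> : ren r (inst k A) = A.
  rewrite ren_ren -[RHS]ren_id; apply: ren_fv => -[|i] ltiA; rewrite /r ?eqxx //.
  by rewrite ltn_eqF // -ltnS (leq_trans ltiA).
have -> // : map (ren r) G = map shift G.
elim: G leGk {der} => //= B G IHG leGk; rewrite IHG => [|C GC]; last by apply: leGk; right.
congr (_ :: _); apply: ren_fv => i ltiB; rewrite /r ltn_eqF //.
by apply: leq_trans ltiB _; apply: leGk; left.
Qed.

(** * Enumeration of formulas, through the countability of finite trees *)

Fixpoint form_tree (A : form) : GenTree.tree nat :=
  match A with
  | Bot => GenTree.Node 0 [::]
  | Eq i j => GenTree.Node 1 [:: GenTree.Leaf i; GenTree.Leaf j]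
  | Elem i j => GenTree.Node 2 [:: GenTree.Leaf i; GenTree.Leaf j]
  | Imp A B => GenTree.Node 3 [:: form_tree A; form_tree B]
  | And A B => GenTree.Node 4 [:: form_tree A; form_tree B]
  | Or A B => GenTree.Node 5 [:: form_tree A; form_tree B]
  | All A => GenTree.Node 6 [:: form_tree A]
  | Ex A => GenTree.Node 7 [:: form_tree A]
  end.

Fixpoint tree_form (t : GenTree.tree nat) : form :=
  match t with
  | GenTree.Node 1 [:: GenTree.Leaf i; GenTree.Leaf j] => Eq i j
  | GenTree.Node 2 [:: GenTree.Leaf i; GenTree.Leaf j] => Elem i j
  | GenTree.Node 3 [:: t; u] => Imp (tree_form t) (tree_form u)
  | GenTree.Node 4 [:: t; u] => And (tree_form t) (tree_form u)
  | GenTree.Node 5 [:: t; u] => Or (tree_form t) (tree_form u)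
  | GenTree.Node 6 [:: t] => All (tree_form t)
  | GenTree.Node 7 [:: t] => Ex (tree_form t)
  | _ => Bot
  end.

Lemma form_treeK : cancel form_tree tree_form.
Proof. by elim=> //= [A -> B ->|A -> B ->|A -> B ->|A ->|A ->]. Qed.

Definition nth_form (n : nat) : form :=
  if unpickle n is Some t then tree_form t else Bot.

Lemma nth_form_surj A : exists n, nth_form n = A.
Proof. by exists (pickle (form_tree A)); rewrite /nth_form pickleK form_treeK. Qed.

(** * The completeness theorem *)

Section Provability.

Implicit Types (S : form -> Prop) (A B : form).

Definition add_form S A : form -> Prop := fun B => S B \/ B = A.

Definition consistent S : Prop := ~ provable S Bot.

Lemma provable_mono S S' A :
  (forall B, S B -> S' B) -> provable S A -> provable S' A.
Proof. by move=> sSS' [G [GS der]]; exists G; split=> // B /GS/sSS'. Qed.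

Lemma provable_hyp S A : S A -> provable S A.
Proof.
by move=> SA; exists [:: A]; split=> [B [<-|[]]|] //; apply: ND_hyp; left.
Qed.

Lemma provable1 S A B : derives [:: A] B -> provable S A -> provable S B.
Proof.
move=> AB [G [GS der]]; exists G; split=> //; apply: ND_impE der.
apply: ND_impI; apply: derives_weak AB _ => C [<-|[]]; by left.
Qed.

Lemma provable2 S A B C :
  derives [:: A; B] C -> provable S A -> provable S B -> provable S C.
Proof.
move=> ABC [G [GS derA]] [G' [G'S derB]]; exists (G ++ G'); split=> [D|].
  by rewrite List.in_app_iff => -[/GS|/G'S].
have GA := derives_weak derA (List.incl_appl G' (@List.incl_refl _ G)).
have GB := derives_weak derB (List.incl_appr G (@List.incl_refl _ G')).
apply: ND_impE GA; apply: ND_impE GB; apply: ND_impI; apply: ND_impI.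
apply: derives_weak ABC _ => D /= [|[|[]]] <-; by [left | right; left].
Qed.

Lemma provable_deduction S A B : provable (add_form S A) B -> provable S (Imp A B).
Proof.
case=> G [GS der].
suff [G' [G'S sGG']]: exists G', (forall C, List.In C G' -> S C) /\ List.incl G (A :: G').
  by exists G'; split=> //; apply: ND_impI; apply: derives_weak der _.
elim: G GS {der} => [_|C G IHG GS]; first by exists [::]; split=> // C [].
have [|G' [G'S sGG']] := IHG; first by move=> D GD; apply: GS; right.
case: (GS C (or_introl erefl)) => [SC|CA].
  exists (C :: G'); split=> [D [<-|/G'S]//|D [<-|/sGG' [->|G'D]]];
    by [right; left|left|right; right].
by exists G'; split=> // D [<-|/sGG'//]; rewrite CA; left.
Qed.

(** Compactness: a derivation uses finitely many hypotheses, and these all lie in one stage of an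
    increasing chain. *)
Lemma provable_chain (S : nat -> form -> Prop) A :
  (forall n B, S n B -> S n.+1 B) ->
  provable (fun B => exists n, S n B) A -> exists n, provable (S n) A.
Proof.
move=> Smono [G [GS der]].
have Sle m n B : m <= n -> S m B -> S n B.
  by move=> /subnK <-; elim: (n - m) => // k IHk /IHk /Smono.
suff [n Gn]: exists n, forall B, List.In B G -> S n B by exists n, G.
elim: G GS {der} => [_|C G IHG GS]; first by exists 0 => B [].
have [|n Gn] := IHG; first by move=> D GD; apply: GS; right.
have [m SmC] := GS C (or_introl erefl); exists (maxn m n) => B [<-|/Gn].
  exact: Sle (leq_maxl _ _) SmC.
exact: Sle (leq_maxr _ _).
Qed.

Lemma provable_contra S A :
  provable (add_form S (Imp A Bot)) Bot -> provable S A.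
Proof.
move/provable_deduction; apply: provable1.
by apply: ND_raa; apply: (@ND_impE _ (Imp A Bot)); apply: ND_hyp; [right; left|left].
Qed.

End Provability.

(** * Tarski semantics *)

Section Semantics.

Variables (M : Type) (E : M -> M -> Prop).

Fixpoint sat (rho : nat -> M) (A : form) : Prop :=
  match A with
  | Bot => False
  | Eq i j => rho i = rho j
  | Elem i j => E (rho i) (rho j)
  | Imp A B => sat rho A -> sat rho B
  | And A B => sat rho A /\ sat rho B
  | Or A B => sat rho A \/ sat rho B
  | All A => forall x, sat (scons x rho) A
  | Ex A => exists x, sat (scons x rho) A
  end.

Lemma sat_ext rho rho' A : (forall i, rho i = rho' i) -> sat rho A <-> sat rho' A.
Proof. by move=> /functional_extensionality ->. Qed.

Lemma sat_ren r rho A : sat rho (ren r A) <-> sat (fun i => rho (r i)) A.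
Proof.
elim: A r rho => [|i j|i j|A IHA B IHB|A IHA B IHB|A IHA B IHB|A IHA|A IHA] r rho //=;
  rewrite ?IHA ?IHB //.
  have E1 x : sat (scons x rho) (ren (up r) A) <-> sat (scons x (fun i => rho (r i))) A.
    by rewrite IHA; apply: sat_ext => -[].
  by split=> h x; apply/E1.
have E1 x : sat (scons x rho) (ren (up r) A) <-> sat (scons x (fun i => rho (r i))) A.
  by rewrite IHA; apply: sat_ext => -[].
by split=> -[x] h; exists x; apply/E1.
Qed.

End Semantics.

(** * Henkin theory and term model of a consistent closed theory *)

Section Henkin.

Variable S0 : form -> Prop.
Hypothesis S0_closed : forall B, S0 B -> fv_bound B = 0.
Hypothesis S0_consistent : consistent S0.

(** The starting theory is closed, so every variable is available as a Henkin constant. The free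
    variables of the first [n] Henkin axioms are below [used_bound n], so [witness n] is fresh for
    these axioms and for the [n]-th formula. *)
Fixpoint used_bound (n : nat) : nat :=
  if n is m.+1 then (maxn (used_bound m) (fv_bound (nth_form m))).+1 else 0.

Definition witness (n : nat) : nat := maxn (used_bound n) (fv_bound (nth_form n)).

Definition henkin_axiom (n : nat) : form :=
  Imp (Ex (nth_form n)) (inst (witness n) (nth_form n)).

Definition henkin_stage (n : nat) (B : form) : Prop :=
  S0 B \/ exists2 i, i < n & B = henkin_axiom i.

Lemma henkin_stage_bound n B : henkin_stage n B -> fv_bound B <= used_bound n.
Proof.
case=> [/S0_closed->//|[i ltin ->]].
apply: (@leq_trans (used_bound i.+1)) => /=; last first.
  elim: n ltin => // n IHn; rewrite ltnS leq_eqVlt => /predU1P[->//|/IHn lein].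
  by apply: leq_trans lein _; apply/leqW/leq_maxl.
rewrite geq_max; apply/andP; split.
  by apply: leq_trans (leq_pred _) _; apply/leqW/leq_maxr.
apply: fv_bound_ren => -[|j] ltj /=; first exact: leqnn.
by rewrite ltnS; apply: leq_trans (ltnW (ltnW ltj)) (leq_maxr _ _).
Qed.

(** If the [n]-th axiom were refutable, stage [n] would prove [Ex B] and also the negation of [B] at
    the witness; freshness of the witness generalizes the latter to [All (Imp B Bot)]. *)
Lemma henkin_stage_consistent n : consistent (henkin_stage n).
Proof.
elim: n => [|n IHn] inc.
  by apply: S0_consistent; apply: provable_mono inc => B [//|[]].
pose B := nth_form n; apply: IHn.
have /provable_deduction incH : provable (add_form (henkin_stage n) (henkin_axiom n)) Bot.
  apply: provable_mono inc => C [|[i]]; first by left; left.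
  rewrite ltnS leq_eqVlt => /predU1P[->|]; first by right.
  by move=> ltin Ci; left; right; exists i.
have exB : provable (henkin_stage n) (Ex B).
  apply: provable1 incH; apply: ND_raa.
  apply: (@ND_impE _ (henkin_axiom n)); first by apply: ND_hyp; right; left.
  apply: ND_impI; apply: ND_raa; apply: (@ND_impE _ (Ex B)).
    by apply: ND_hyp; do 2 right; left.
  by apply: ND_hyp; right; left.
have : provable (henkin_stage n) (inst (witness n) (Imp B Bot)).
  apply: provable1 incH; apply: ND_impI.
  apply: (@ND_impE _ (henkin_axiom n)); first by apply: ND_hyp; right; left.
  by apply: ND_impI; apply: ND_hyp; right; left.
case=> G [GS der].
have allB : provable (henkin_stage n) (All (Imp B Bot)).
  exists G; split=> //; apply: derives_gen der.
    by move=> C /GS/henkin_stage_bound leC; apply: leq_trans leC (leq_maxl _ _).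
  by rewrite /= maxn0; apply/leqW/leq_maxr.
apply: provable2 exB allB; apply: (@ND_exE _ B); first by apply: ND_hyp; left.
apply: (@ND_impE _ B); last by apply: ND_hyp; left.
have unshift : inst 0 (ren (up S) (Imp B Bot)) = Imp B Bot.
  by rewrite /inst ren_ren -[RHS]ren_id; apply: ren_ext => -[].
rewrite -[X in derives _ X]unshift.
by apply: ND_allE; apply: ND_hyp; do 2 right; left.
Qed.

(** Stage 0 is already the union of all Henkin stages; each later stage settles one formula of the
    enumeration. *)
Fixpoint lindenbaum (n : nat) (B : form) : Prop :=
  if n is m.+1 then
    lindenbaum m B \/ (B = nth_form m /\ consistent (add_form (lindenbaum m) B))
  else exists i, henkin_stage i B.

Definition henkin_theory (B : form) : Prop := exists n, lindenbaum n B.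

Lemma henkin_theory_consistent : consistent henkin_theory.
Proof.
move=> /(provable_chain (S := lindenbaum)) [n B|n]; first by left.
elim: n => [|n IHn] /=.
  move=> /(provable_chain (S := henkin_stage)) [i B [|[j ltji ->]]|i].
  - by left.
  - by right; exists j => //; apply: leqW.
  - exact: henkin_stage_consistent.
case: (classic (consistent (add_form (lindenbaum n) (nth_form n)))) => cons inc.
  by apply: cons; apply: provable_mono inc => B [|[-> _]]; [left|right].
apply: IHn; apply: provable_mono inc => B [//|[-> cons']].
by case: cons.
Qed.

Lemma henkin_theory_max B : consistent (add_form henkin_theory B) -> henkin_theory B.
Proof.
move=> cons; have [n defB] := nth_form_surj B; exists n.+1; right; split=> // inc.
apply: cons; apply: provable_mono inc => C [Cn|->]; last by right.
by left; exists n.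
Qed.

Lemma henkin_theory_closed B : provable henkin_theory B -> henkin_theory B.
Proof.
move=> prB; apply: henkin_theory_max => /provable_deduction prNB.
apply: henkin_theory_consistent; apply: provable2 prNB prB.
by apply: (@ND_impE _ B); apply: ND_hyp; [left|right; left].
Qed.

Local Notation "|- B" := (henkin_theory B) (at level 75).

Lemma theory1 A B : derives [:: A] B -> |- A -> |- B.
Proof. by move=> AB TA; apply/henkin_theory_closed/(provable1 AB)/provable_hyp. Qed.

Lemma theory2 A B C : derives [:: A; B] C -> |- A -> |- B -> |- C.
Proof.
by move=> ABC TA TB; apply/henkin_theory_closed/(provable2 ABC); apply: provable_hyp.
Qed.

Lemma theory_Bot : ~ |- Bot.
Proof. by move=> /provable_hyp /henkin_theory_consistent. Qed.

Lemma theory_Imp A B : |- Imp A B <-> (|- A -> |- B).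
Proof.
split=> [AB TA|AB].
  apply: theory2 AB TA.
  by apply: (@ND_impE _ A); apply: ND_hyp; [left|right; left].
case: (classic (|- A)) => [/AB|NA].
  by apply: theory1; apply: ND_impI; apply: ND_hyp; right; left.
apply: NNPP => NAB; apply: NA; apply: henkin_theory_max => incA.
apply: NAB; apply: henkin_theory_closed; apply: provable_deduction.
have [G [GS der]] := incA; exists G; split=> //; apply: ND_raa.
by apply: derives_weak der _; apply: List.incl_tl; apply: List.incl_refl.
Qed.

Lemma theory_And A B : |- And A B <-> |- A /\ |- B.
Proof.
split=> [AB|[]].
  by split; apply: theory1 AB; [apply: ND_andE1|apply: ND_andE2]; apply: ND_hyp; left.
by apply: theory2; apply: ND_andI; apply: ND_hyp; [left|right; left].
Qed.

Lemma theory_Or A B : |- Or A B <-> |- A \/ |- B.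
Proof.
split=> [AB|[]]; last 2 first.
- by apply: theory1; apply: ND_orI1; apply: ND_hyp; left.
- by apply: theory1; apply: ND_orI2; apply: ND_hyp; left.
case: (classic (|- A)) => NA; [by left|right].
have : |- Imp A B by apply/theory_Imp.
apply: theory2 AB; apply: (ND_orE (A := A) (B := B)).
- by apply: ND_hyp; left.
- by apply: (@ND_impE _ A); apply: ND_hyp; [do 2 right; left|left].
- by apply: ND_hyp; left.
Qed.

Lemma theory_Ex A : |- Ex A <-> exists k, |- inst k A.
Proof.
split=> [exA|[k]]; last first.
  by apply: theory1; apply: (@ND_exI _ _ k); apply: ND_hyp; left.
have [n defA] := nth_form_surj A; exists (witness n).
have : |- henkin_axiom n.
  by exists 0, n.+1; right; exists n.
by rewrite /henkin_axiom defA => /theory_Imp; apply.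
Qed.

(** Henkin axioms provide witnesses for existentials only. A universal that fails is turned into the
    existential of the negation, whose witness contradicts the corresponding instance. *)
Lemma theory_All A : |- All A <-> forall k, |- inst k A.
Proof.
split=> [allA k|allA].
  by apply: theory1 allA; apply: ND_allE; apply: ND_hyp; left.
apply: NNPP => NallA.
have : |- Imp (All A) Bot by apply/theory_Imp.
have shiftK (B : form) : inst 0 (ren (up S) B) = B.
  by rewrite /inst ren_ren -[RHS]ren_id; apply: ren_ext => -[].
have NallA_ex : derives [:: Imp (All A) Bot] (Ex (Imp A Bot)).
  apply: ND_raa; apply: (@ND_impE _ (All A)).
    by apply: ND_hyp; right; left.
  apply: ND_allI; apply: ND_raa.
  apply: (@ND_impE _ (shift (Ex (Imp A Bot)))).
    by apply: ND_hyp; right; left.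
  by apply: (@ND_exI _ _ 0); rewrite [X in derives _ X](shiftK (Imp A Bot)); apply: ND_hyp; left.
move=> /(theory1 NallA_ex) /theory_Ex[k] Nk.
have /theory_Imp /(_ (allA k)) : |- Imp (inst k A) Bot by [].
exact: theory_Bot.
Qed.

(** Variables are identified when the theory proves them equal. [epsilon] receives the whole class
    as a predicate, and equal variables have equal predicates, so it returns one common
    representative. *)
Definition var_class (i : nat) : nat :=
  epsilon (inhabits 0) (fun j => |- Eq i j).

Lemma theory_refl i : |- Eq i i.
Proof. by apply: henkin_theory_closed; exists [::]; split=> //; apply: ND_eqI. Qed.

Lemma theory_rewrite A i j : |- Eq i j -> |- inst i A -> |- inst j A.
Proof.
by apply: theory2; apply: (@ND_eqE _ _ i); apply: ND_hyp; [left|right; left].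
Qed.

Lemma theory_sym i j : |- Eq i j -> |- Eq j i.
Proof. by move=> /(@theory_rewrite (Eq 0 i.+1)); apply; apply: theory_refl. Qed.

Lemma theory_trans i j k : |- Eq i j -> |- Eq j k -> |- Eq i k.
Proof. by move=> ij /(@theory_rewrite (Eq i.+1 0)); apply. Qed.

Lemma var_classP i : |- Eq i (var_class i).
Proof. exact: (@epsilon_spec _ _ (fun j => |- Eq i j) (ex_intro _ i (theory_refl i))). Qed.

Lemma var_class_eq i j : var_class i = var_class j <-> |- Eq i j.
Proof.
split=> [eqij|ij].
  apply: theory_trans (var_classP i) _; rewrite eqij; exact/theory_sym/var_classP.
rewrite /var_class; congr epsilon; apply: functional_extensionality => k.
apply: propositional_extensionality.
split; [exact: theory_trans (theory_sym ij)|exact: theory_trans ij].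
Qed.

Definition term_model : Type := {i : nat | var_class i == i}.

Definition term (i : nat) : term_model.
Proof.
by exists (var_class i); apply/eqP/var_class_eq; apply/theory_sym/var_classP.
Defined.

Lemma term_eq i j : term i = term j <-> |- Eq i j.
Proof.
rewrite -var_class_eq; split=> [/(congr1 val)//|eqij]; exact: val_inj.
Qed.

Lemma term_surj (x : term_model) : exists i, x = term i.
Proof. by exists (val x); apply: val_inj; rewrite /= (eqP (valP x)). Qed.

Definition term_mem (x y : term_model) : Prop := |- Elem (val x) (val y).

Lemma term_mem_term i j : term_mem (term i) (term j) <-> |- Elem i j.
Proof.
have := var_classP j; have := var_classP i; rewrite /term_mem /=.
set i' := var_class i; set j' := var_class j => ii' jj'.
have memL k l m : |- Eq k l -> |- Elem k m -> |- Elem l m.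
  by apply: (@theory_rewrite (Elem 0 m.+1)).
have memR k l m : |- Eq k l -> |- Elem m k -> |- Elem m l.
  by apply: (@theory_rewrite (Elem m.+1 0)).
split=> [ij|]; last by move=> /(memL _ _ _ ii')/(memR _ _ _ jj').
by apply: memL (theory_sym ii') _; apply: memR (theory_sym jj') _.
Qed.

(** The truth lemma. It is stated for every renaming [r] because passing under a binder prepends the
    class of some variable to the assignment. *)
Lemma sat_term r A : sat term_mem (fun i => term (r i)) A <-> |- ren r A.
Proof.
have consE k r0 B : sat term_mem (scons (term k) (fun i => term (r0 i))) B <->
    sat term_mem (fun i => term (scons k r0 i)) B.
  by apply: sat_ext => -[].
have instE k r0 B : inst k (ren (up r0) B) = ren (scons k r0) B.
  by rewrite /inst ren_ren; apply: ren_ext => -[].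
elim: A r => [|i j|i j|A IHA B IHB|A IHA B IHB|A IHA B IHB|A IHA|A IHA] r /=.
- by split=> // /theory_Bot.
- exact: term_eq.
- exact: term_mem_term.
- by rewrite IHA IHB theory_Imp.
- by rewrite IHA IHB theory_And.
- by rewrite IHA IHB theory_Or.
- rewrite theory_All; split=> [h k|h x].
    by rewrite instE -IHA -consE.
  by have [k ->] := term_surj x; rewrite consE IHA -instE.
rewrite theory_Ex; split=> [[x]|[k]].
  by have [k ->] := term_surj x; rewrite consE IHA -instE; exists k.
by rewrite instE -IHA -consE; exists (term k).
Qed.

End Henkin.

Theorem completeness (T : form -> Prop) A :
    (forall B, T B -> fv_bound B = 0) -> fv_bound A = 0 ->
    (forall (M : Type) (E : M -> M -> Prop) rho,
       (forall B, T B -> sat E rho B) -> sat E rho A) ->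
  provable T A.
Proof.
move=> T0 A0 TA; apply: provable_contra; apply: NNPP => cons.
have S0 B : add_form T (Imp A Bot) B -> fv_bound B = 0.
  by case=> [/T0|->] //=; rewrite A0.
pose rho i := term S0 cons (id i).
have model B : add_form T (Imp A Bot) B -> sat (@term_mem _) rho B.
  by move=> SB; apply/(sat_term S0 cons id); rewrite ren_id; exists 0, 0; left.
have : sat (@term_mem _) rho (Imp A Bot) by apply: model; right.
by move=> /=; apply; apply: TA => B TB; apply: model; left.
Qed.

Lemma sat_closed (M : Type) (E : M -> M -> Prop) rho rho' A :
  fv_bound A = 0 -> sat E rho A <-> sat E rho' A.
Proof.
(* Both assignments are renamings of the one assignment [tau] that interleaves them, and a closed
   formula is invariant under renaming. *)
move=> A0; pose tau i := if odd i then rho' i./2 else rho i./2.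
have double_tau : sat E tau A <-> sat E rho A.
  rewrite -{1}(ren_closed double A0) sat_ren; apply: sat_ext => i.
  by rewrite /tau odd_double doubleK.
have doubleS_tau : sat E tau A <-> sat E rho' A.
  rewrite -{1}(ren_closed (fun i => i.*2.+1) A0) sat_ren; apply: sat_ext => i.
  by rewrite /tau oddS odd_double /= uphalf_double.
by rewrite -double_tau.
Qed.

Lemma univ_closure_closed A : fv_bound (univ_closure A) = 0.
Proof.
suff -> n : fv_bound (iter n All A) = fv_bound A - n by rewrite subnn.
by elim: n => [|n /= ->]; rewrite ?subn0 // subnS.
Qed.

Lemma ZF_closed B : ZF B -> fv_bound B = 0.
Proof. by case=> // A; apply: univ_closure_closed. Qed.

(** * Set theory inside a model of ZF *)

Section Model.

Variables (M : Type) (E : M -> M -> Prop).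

Local Notation "x ∈ y" := (E x y) : type_scope.

(* Each predicate below is convertible to the satisfaction in (M, E) of the
   formula that has the same name in lower case (SB1 to SB5 stand for B1 to B5). *)

Definition Sub (a b : M) : Prop := forall x, x ∈ a -> x ∈ b.
Definition Is_empty (a : M) : Prop := forall x, ~ x ∈ a.
Definition Nonempty (a : M) : Prop := exists x, x ∈ a.
Definition Meets (a b : M) : Prop := exists x, x ∈ a /\ x ∈ b.
Definition Is_inter (c a b : M) : Prop := forall x, x ∈ c <-> x ∈ a /\ x ∈ b.
Definition Is_union (u s : M) : Prop := forall x, x ∈ u <-> exists a, a ∈ s /\ x ∈ a.
Definition Is_diff (c a b : M) : Prop := forall x, x ∈ c <-> x ∈ a /\ ~ x ∈ b.
Definition Is_pair (p a b : M) : Prop := forall x, x ∈ p <-> x = a \/ x = b.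
Definition Is_succ (y x : M) : Prop := forall z, z ∈ y <-> z ∈ x \/ z = x.
Definition Is_opair (p a b : M) : Prop :=
  exists s t, Is_pair s a a /\ Is_pair t a b /\ Is_pair p s t.
Definition Opair_in (a b r : M) : Prop := exists p, Is_opair p a b /\ p ∈ r.
Definition Is_prod (c a b : M) : Prop :=
  forall p, p ∈ c <-> exists x, x ∈ a /\ exists y, y ∈ b /\ Is_opair p x y.
Definition Is_rel (r a b : M) : Prop :=
  forall p, p ∈ r -> exists x, x ∈ a /\ exists y, y ∈ b /\ Is_opair p x y.
Definition Is_fun (f a b : M) : Prop :=
  Is_rel f a b /\
  forall x, x ∈ a -> exists y, Opair_in x y f /\ forall z, Opair_in x z f -> z = y.
Definition Is_bij (f a b : M) : Prop :=
  Is_fun f a b /\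
  (forall x y z, Opair_in x z f /\ Opair_in y z f -> x = y) /\
  forall y, y ∈ b -> exists x, Opair_in x y f.
Definition Equipotent (a b : M) : Prop := exists f, Is_bij f a b.
Definition Inductive_set (w : M) : Prop :=
  (exists e, e ∈ w /\ Is_empty e) /\
  forall x, x ∈ w -> exists y, y ∈ w /\ Is_succ y x.
Definition Is_omega (w : M) : Prop :=
  Inductive_set w /\ forall v, Inductive_set v -> Sub w v.
Definition Finite (a : M) : Prop :=
  exists w, Is_omega w /\ exists n, n ∈ w /\ Equipotent a n.
Definition Denumerable (a : M) : Prop := exists w, Is_omega w /\ Equipotent a w.
Definition Countable (a : M) : Prop :=
  exists w, Is_omega w /\ exists s, Sub s w /\ Equipotent a s.

Definition Is_binop (f r : M) : Prop := exists c, Is_prod c r r /\ Is_fun f c r.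
Definition Op (f x y z : M) : Prop := exists p, Is_opair p x y /\ Opair_in p z f.
Definition Op_comm (f : M) : Prop := forall x y z, Op f x y z -> Op f y x z.
Definition Op_assoc (f : M) : Prop :=
  forall x y z xy yz t, Op f x y xy /\ Op f y z yz /\ Op f xy z t -> Op f x yz t.
Definition Op_unit (r f e : M) : Prop := e ∈ r /\ forall x, x ∈ r -> Op f x e x.
Definition Is_field (r add mul zero one : M) : Prop :=
  Is_binop add r /\ Op_assoc add /\ Op_comm add /\ Op_unit r add zero /\
  (forall x, x ∈ r -> exists y, y ∈ r /\ Op add x y zero) /\
  Is_binop mul r /\ Op_assoc mul /\ Op_comm mul /\ Op_unit r mul one /\
  (forall x, x ∈ r -> ~ x = zero -> exists y, y ∈ r /\ Op mul x y one) /\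
  ~ zero = one /\
  (forall x y z yz xy xz t,
     Op add y z yz /\ Op mul x yz t /\ Op mul x y xy /\ Op mul x z xz ->
     Op add xy xz t).
Definition Is_strict_total_order (r lt : M) : Prop :=
  Is_rel lt r r /\
  (forall x, ~ Opair_in x x lt) /\
  (forall x y z, Opair_in x y lt /\ Opair_in y z lt -> Opair_in x z lt) /\
  (forall x, x ∈ r -> forall y, y ∈ r -> Opair_in x y lt \/ x = y \/ Opair_in y x lt).
Definition Le_in (lt x y : M) : Prop := Opair_in x y lt \/ x = y.
Definition Is_upper_bound (lt s b : M) : Prop := forall x, x ∈ s -> Le_in lt x b.
Definition Dedekind_complete (r lt : M) : Prop :=
  forall s,
  Sub s r /\ Nonempty s /\ (exists b, b ∈ r /\ Is_upper_bound lt s b) ->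
  exists b, b ∈ r /\ Is_upper_bound lt s b /\
    forall c, c ∈ r -> Is_upper_bound lt s c -> Le_in lt b c.
Definition Is_reals (r add mul zero one lt : M) : Prop :=
  Is_field r add mul zero one /\
  Is_strict_total_order r lt /\
  (forall x y z xz yz,
     Opair_in x y lt /\ Op add x z xz /\ Op add y z yz -> Opair_in xz yz lt) /\
  (forall x y xy,
     Opair_in zero x lt /\ Opair_in zero y lt /\ Op mul x y xy ->
     Opair_in zero xy lt) /\
  Dedekind_complete r lt.
Definition Open_in_reals (r lt u : M) : Prop :=
  Sub u r /\
  forall y, y ∈ u -> exists a b, Opair_in a y lt /\ Opair_in y b lt /\
    forall z, Opair_in a z lt /\ Opair_in z b lt -> z ∈ u.

Definition Is_topology (X T : M) : Prop :=
  (forall U, U ∈ T -> Sub U X) /\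
  (exists U, U ∈ T /\ Is_empty U) /\ X ∈ T /\
  (forall U, U ∈ T -> forall V, V ∈ T -> exists W, W ∈ T /\ Is_inter W U V) /\
  (forall D, Sub D T -> exists W, W ∈ T /\ Is_union W D).
Definition Is_nbhd (X T N x : M) : Prop :=
  Sub N X /\ exists U, U ∈ T /\ x ∈ U /\ Sub U N.
Definition Is_closed (X T C : M) : Prop := Sub C X /\ exists U, U ∈ T /\ Is_diff U X C.
Definition In_closure (X T A x : M) : Prop :=
  x ∈ X /\ forall C, Is_closed X T C /\ Sub A C -> x ∈ C.
Definition Is_trace (G F N : M) : Prop := forall A, A ∈ G <-> A ∈ F /\ Meets A N.
Definition Locally_finite (X T F : M) : Prop :=
  forall x, x ∈ X -> exists N, Is_nbhd X T N x /\ exists G, Is_trace G F N /\ Finite G.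
Definition Pairwise_disjoint (F : M) : Prop :=
  forall A, A ∈ F -> forall B, B ∈ F -> ~ A = B -> ~ Meets A B.
Definition Nonempty_members (F : M) : Prop := forall A, A ∈ F -> Nonempty A.
Definition Cellular (T F : M) : Prop :=
  Sub F T /\ Nonempty_members F /\ Pairwise_disjoint F.
Definition Cluster_point (X T F x : M) : Prop :=
  x ∈ X /\ forall N, Is_nbhd X T N x -> exists G, Is_trace G F N /\ ~ Finite G.
Definition Filter_base (X F : M) : Prop :=
  (forall A, A ∈ F -> Sub A X) /\ Nonempty_members F /\
  forall A, A ∈ F -> forall B, B ∈ F -> exists C, C ∈ F /\
    forall x, x ∈ C -> x ∈ A /\ x ∈ B.
Definition Adherence_point (X T F x : M) : Prop :=
  x ∈ X /\ forall A, A ∈ F -> In_closure X T A x.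
Definition Continuous_to_reals (X T r lt f : M) : Prop :=
  Is_fun f X r /\
  forall V, Open_in_reals r lt V ->
    exists U, U ∈ T /\ forall x, x ∈ U <-> exists y, y ∈ V /\ Opair_in x y f.
Definition Bounded_fun (r lt f : M) : Prop :=
  exists a, a ∈ r /\ exists b, b ∈ r /\
    forall x y, Opair_in x y f -> Le_in lt a y /\ Le_in lt y b.
Definition Pseudocompact (X T : M) : Prop :=
  forall r add mul zero one lt, Is_reals r add mul zero one lt ->
  forall f, Continuous_to_reals X T r lt f -> Bounded_fun r lt f.
Definition SB1 (X T : M) : Prop :=
  forall U, Countable U /\ Sub U T /\ Is_union X U ->
    exists V, Sub V U /\ Finite V /\
      forall x, x ∈ X <-> exists A, A ∈ V /\ In_closure X T A x.
Definition SB2 (X T : M) : Prop :=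
  forall F, Denumerable F /\ Sub F T /\ Nonempty_members F ->
    exists x, Cluster_point X T F x.
Definition SB3 (X T : M) : Prop :=
  forall F, Denumerable F /\ Cellular T F -> exists x, Cluster_point X T F x.
Definition SB4 (X T : M) : Prop :=
  forall F, Countable F /\ Sub F T /\ Filter_base X F ->
    exists x, Adherence_point X T F x.
Definition SB5 (X T : M) : Prop :=
  forall F, Countable F /\ Sub F T /\ Locally_finite X T F /\ Pairwise_disjoint F ->
    Finite F.

(** ** Definability *)

Definition mix (rho s : nat -> M) (i : nat) : M := if odd i then s i./2 else rho i./2.

(* P is definable with parameters: the even variables carry rho, the odd ones
   the parameters. *)
Definition Def (P : (nat -> M) -> Prop) : Prop :=
  exists A s, forall rho, P rho <-> sat E (mix rho s) A.

(* t is definable when its graph is; variable 0 is the value of t. *)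
Definition DefT (t : (nat -> M) -> M) : Prop :=
  Def (fun rho => rho 0 = t (fun i => rho i.+1)).

Lemma odd_doubleS k : odd k.*2.+1 = true.
Proof. by rewrite oddS odd_double. Qed.

Lemma half_doubleS k : k.*2.+1./2 = k.
Proof. exact: (half_bit_double k true). Qed.

(** Two definitions come with two parameter lists; interleaving these lists lets both formulas share
    a single one. The members of [s] sit at the even places of [mix s t], which doubles the index of
    each parameter. *)
Lemma sat_mixl A rho s t :
  sat E (mix rho s) A <->
  sat E (mix rho (mix s t))
    (ren (fun i => if odd i then (i./2).*2.*2.+1 else i) A).
Proof.
rewrite sat_ren; apply: sat_ext => i; rewrite /mix; case: ifP => oi; last by rewrite oi.
by rewrite odd_doubleS half_doubleS odd_double doubleK.
Qed.

Lemma sat_mixr A rho s t :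
  sat E (mix rho t) A <->
  sat E (mix rho (mix s t))
    (ren (fun i => if odd i then (i./2).*2.+1.*2.+1 else i) A).
Proof.
rewrite sat_ren; apply: sat_ext => i; rewrite /mix; case: ifP => oi; last by rewrite oi.
by rewrite !(odd_doubleS, half_doubleS).
Qed.

Lemma Def_ext P Q : (forall rho, P rho <-> Q rho) -> Def P -> Def Q.
Proof. by move=> PQ [A [s AP]]; exists A, s => rho; rewrite -AP PQ. Qed.

Hypothesis model : forall rho B, ZF B -> sat E rho B.
Variable m0 : M.

Lemma Def2 P Q : Def P -> Def Q -> exists A B s, forall rho,
  (P rho <-> sat E (mix rho s) A) /\ (Q rho <-> sat E (mix rho s) B).
Proof.
move=> [A [s AP]] [B [t BQ]]; do 2 eexists; exists (mix s t) => rho.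
by split; [exact: iff_trans (AP _) (sat_mixl _ _ _ _)|exact: iff_trans (BQ _) (sat_mixr _ _ _ _)].
Qed.

Lemma Def_imp P Q : Def P -> Def Q -> Def (fun rho => P rho -> Q rho).
Proof.
move=> DP DQ; have [A [B [s AB]]] := Def2 DP DQ; exists (Imp A B), s => rho /=.
by have [-> ->] := AB rho.
Qed.

Lemma Def_and P Q : Def P -> Def Q -> Def (fun rho => P rho /\ Q rho).
Proof.
move=> DP DQ; have [A [B [s AB]]] := Def2 DP DQ; exists (And A B), s => rho /=.
by have [-> ->] := AB rho.
Qed.

Lemma Def_or P Q : Def P -> Def Q -> Def (fun rho => P rho \/ Q rho).
Proof.
move=> DP DQ; have [A [B [s AB]]] := Def2 DP DQ; exists (Or A B), s => rho /=.
by have [-> ->] := AB rho.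
Qed.

Lemma Def_iff P Q : Def P -> Def Q -> Def (fun rho => P rho <-> Q rho).
Proof. by move=> DP DQ; apply: Def_and; apply: Def_imp. Qed.

(** A proposition that ignores the assignment is, classically, true or false in the metatheory,
    hence equivalent to a fixed sentence. *)
Lemma Def_const (P : Prop) : Def (fun=> P).
Proof.
case: (classic P) => HP; last by exists Bot, (fun=> m0).
by exists (Imp Bot Bot), (fun=> m0) => rho; split=> // _ [].
Qed.

Lemma Def_not P : Def P -> Def (fun rho => ~ P rho).
Proof. by move=> DP; apply: (Def_imp DP); apply: Def_const. Qed.

Lemma sat_mix_scons A x rho s :
  sat E (mix (scons x rho) s) A <->
  sat E (scons x (mix rho s)) (ren (fun i => if odd i then i.+1 else i.-1) A).
Proof.
rewrite sat_ren; apply: sat_ext => i; rewrite /mix; case: ifP => oi /=.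
  by rewrite oi.
case: i oi => [|[|i]] //=; rewrite negbK => oi.
by rewrite oi.
Qed.

(** [P] takes the quantified value as a separate argument, so that unification can match it with a
    Rocq binder; the premise stores this value at position 0. *)
Lemma Def_all (P : M -> (nat -> M) -> Prop) :
  Def (fun rho => P (rho 0) (fun i => rho i.+1)) -> Def (fun rho => forall x, P x rho).
Proof.
case=> A [s AP]; eexists (All _), s => rho; split=> [h x|h x].
  by apply/sat_mix_scons/AP/h.
by have /sat_mix_scons/AP := h x.
Qed.

Lemma Def_ex (P : M -> (nat -> M) -> Prop) :
  Def (fun rho => P (rho 0) (fun i => rho i.+1)) -> Def (fun rho => exists x, P x rho).
Proof.
case=> A [s AP]; eexists (Ex _), s => rho; split=> -[x h]; exists x.
  by apply/sat_mix_scons/AP/h.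
by have /sat_mix_scons/AP := h.
Qed.

Lemma Def_subst P (g : nat -> nat + M) :
  Def P -> Def (fun rho => P (fun i => match g i with inl j => rho j | inr c => c end)).
Proof.
case=> A [s AP].
exists (ren (fun i => if odd i then (i./2).*2.*2.+1 else
                      if g i./2 is inl j then j.*2 else (i./2).*2.+1.*2.+1) A).
exists (mix s (fun i => if g i is inr c then c else m0)) => rho.
rewrite AP sat_ren; apply: sat_ext => i; rewrite /mix; case: ifP => oi.
  by rewrite !(odd_doubleS, half_doubleS, odd_double, doubleK).
case gi: (g i./2) => [j|c]; first by rewrite odd_double doubleK.
by rewrite !(odd_doubleS, half_doubleS) gi.
Qed.

Lemma Def_ren P (f : nat -> nat) : Def P -> Def (fun rho => P (fun i => rho (f i))).
Proof. exact: (@Def_subst P (fun i => inl (f i))). Qed.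

Lemma Def_fix (P : M -> (nat -> M) -> Prop) rho :
  Def (fun rho => P (rho 0) (fun i => rho i.+1)) -> Def (fun rho' => P (rho' 0) rho).
Proof. exact: (@Def_subst _ (fun i => if i is j.+1 then inr (rho j) else inl 0)). Qed.

Lemma DefT_ren t (f : nat -> nat) : DefT t -> DefT (fun rho => t (fun i => rho (f i))).
Proof. exact: (@Def_ren _ (fun i => if i is j.+1 then (f j).+1 else 0)). Qed.

(** The only terms of the language are variables, so a definable term is substituted through its
    graph: some [x] equals [t rho] and satisfies [P]. *)
Lemma Def_app (P : M -> (nat -> M) -> Prop) t :
  Def (fun rho => P (rho 0) (fun i => rho i.+1)) -> DefT t -> Def (fun rho => P (t rho) rho).
Proof.
move=> DP Dt; apply: (@Def_ext (fun rho => exists x, x = t rho /\ P x rho)).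
  by move=> rho; split=> [[x [->]]//|Pt]; exists (t rho).
exact/Def_ex/Def_and.
Qed.

Lemma Def_var_eq i j : Def (fun rho => rho i = rho j).
Proof.
exists (Eq i.*2 j.*2), (fun=> m0) => rho.
by rewrite /= /mix !odd_double !doubleK.
Qed.

Lemma Def_var_mem i j : Def (fun rho => rho i ∈ rho j).
Proof.
exists (Elem i.*2 j.*2), (fun=> m0) => rho.
by rewrite /= /mix !odd_double !doubleK.
Qed.

Lemma DefT_var i : DefT (fun rho => rho i).
Proof. exact: Def_var_eq. Qed.

Lemma DefT_const c : DefT (fun=> c).
Proof.
exact: (@Def_subst _ (fun i => if i is 0 then inl 0 else inr c) (Def_var_eq 0 1)).
Qed.

Lemma Def_eq s t : DefT s -> DefT t -> Def (fun rho => s rho = t rho).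
Proof. by move=> Ds Dt; apply: (Def_app (P := fun x rho => x = t rho)). Qed.

Lemma Def_mem s t : DefT s -> DefT t -> Def (fun rho => s rho ∈ t rho).
Proof.
move=> Ds Dt; apply: (Def_app (P := fun x rho => x ∈ t rho)) => //.
apply: (Def_app (P := fun y rho => rho 0 ∈ y)); first exact: Def_var_mem.
exact: DefT_ren.
Qed.

Definition Def1 (P : M -> Prop) : Prop := Def (fun rho => P (rho 0)).
Definition Rel_def (P : M -> M -> Prop) : Prop := Def (fun rho => P (rho 0) (rho 1)).
Definition Fun_def (h : M -> M) : Prop := DefT (fun rho => h (rho 0)).

Lemma Def_rel P s t : Rel_def P -> DefT s -> DefT t -> Def (fun rho => P (s rho) (t rho)).
Proof.
move=> DP Ds Dt; apply: (Def_app (P := fun x rho => P x (t rho))) => //.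
apply: (Def_app (P := fun y rho => P (rho 0) y)); last exact: DefT_ren.
by apply: (Def_ren (fun i => if i is 0 then 1 else 0) DP).
Qed.

Lemma Def_pred P t : Def1 P -> DefT t -> Def (fun rho => P (t rho)).
Proof. by move=> DP; apply: (Def_app (P := fun x rho => P x)). Qed.

Lemma DefT_fun h t : Fun_def h -> DefT t -> DefT (fun rho => h (t rho)).
Proof.
move=> Dh Dt; apply: (Def_app (P := fun x rho => rho 0 = h x)); last exact: DefT_ren.
by apply: (Def_ren (fun i => if i is 0 then 1 else 0) Dh).
Qed.

Lemma DefT_if P s t : Def P -> DefT s -> DefT t ->
  DefT (fun rho => if excluded_middle_informative (P rho) then s rho else t rho).
Proof.
move=> DP Ds Dt.
apply: (@Def_ext (fun rho => (P (fun i => rho i.+1) /\ rho 0 = s (fun i => rho i.+1)) \/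
                  (~ P (fun i => rho i.+1) /\ rho 0 = t (fun i => rho i.+1)))).
  move=> rho; case: excluded_middle_informative => HP.
    by split=> [[[]|[/(_ HP)]]|] //; left.
  by split=> [[[/HP]|[]]|] //; right.
by apply: Def_or; apply: Def_and => //; [|apply: Def_not]; apply: Def_ren.
Qed.

(** The hook is redefined once the set operations have their definability lemmas, so that
    [definable] decomposes them too. *)
Ltac def_hook := fail.

(** Definability facts in the context are tried before connectives. A defined notion can be unfolded
    by unification down to its connectives; a fact such as [def_equip] is put in the context to be
    used instead. *)
Ltac def_step :=
  cbv beta delta [Def1 Rel_def Fun_def];
  lazymatch goal with
  | |- DefT _ =>
    first [ apply DefT_var | apply DefT_const
          | match goal with
            | H : DefT ?a |- DefT (fun rho => ?a _) => apply (DefT_ren _ H)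
            | H : Fun_def ?h |- DefT (fun rho => ?h _) => apply (DefT_fun H)
            end
          | apply DefT_if | def_hook ]
  | |- Def _ =>
    first [ apply Def_const | apply Def_eq | apply Def_mem
          | match goal with
            | H : Def1 ?P |- Def (fun rho => ?P _) => apply (Def_pred H)
            | H : Rel_def ?P |- Def (fun rho => ?P _ _) => apply (Def_rel H)
            | H : Def (fun rho => ?P (rho 0) (fun i => rho i.+1))
              |- Def (fun rho => ?P (rho 0) _) =>
              apply (Def_ren (fun i => if i is j.+1 then _ else 0) H)
            end
          | def_hook
          | apply Def_and | apply Def_or | apply Def_not | apply Def_imp
          | apply Def_all | apply Def_ex | apply Def_iff ]
  end.

Ltac definable := repeat def_step.

Lemma ext a b : (forall x, x ∈ a <-> x ∈ b) -> a = b.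
Proof. by move: a b; apply: (model (fun=> m0) ZF_extensionality). Qed.

Lemma foundation a : Nonempty a -> exists x, x ∈ a /\ ~ Meets x a.
Proof. by move: a; apply: (model (fun=> m0) ZF_foundation). Qed.

Lemma sat_univ_closure A rho : (forall rho, sat E rho (univ_closure A)) -> sat E rho A.
Proof.
rewrite /univ_closure; elim: (fv_bound A) rho => //= n IHn rho h; apply: IHn => rho'.
have := h (fun i => rho' i.+1) (rho' 0).
by apply: (iffLR (sat_ext _ _ _)) => -[].
Qed.

(** [epsilon] acts in the metatheory and gives the model no choice: by extensionality at most one
    set has the required members, which makes the graph of [setof] definable when [P] is. *)
Definition setof (P : M -> Prop) : M :=
  epsilon (inhabits m0) (fun b => forall x, x ∈ b <-> P x).

Definition Is_set (P : M -> Prop) : Prop := exists b, forall x, x ∈ b <-> P x.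

Lemma setofP P : Is_set P -> forall x, x ∈ setof P <-> P x.
Proof. exact: epsilon_spec. Qed.

Lemma DefT_setof (P : M -> (nat -> M) -> Prop) :
  (forall rho, Is_set (fun x => P x rho)) ->
  Def (fun rho => P (rho 0) (fun i => rho i.+1)) -> DefT (fun rho => setof (fun x => P x rho)).
Proof.
move=> setP DP.
apply: (@Def_ext (fun rho => forall x, x ∈ rho 0 <-> P x (fun i => rho i.+1))).
  move=> rho; split=> [h|-> x]; last exact: setofP.
  by apply: ext => x; rewrite h setofP.
apply: Def_all; apply: Def_iff; first exact: Def_var_mem.
exact: (Def_ren (fun i => if i is j.+1 then j.+2 else 0) DP).
Qed.

Lemma is_set_sub a P : (forall x, P x -> x ∈ a) -> Def1 P -> Is_set P.
Proof.
move=> Pa [A [s AP]].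
(* [P] looks at position 0 only, so all even positions may be sent to the element [x], variable 0 of
   the separation instance; the parameters follow from variable 1 on. *)
pose A' := ren (fun i => if odd i then i./2.+1 else 0) A.
have /(_ a)[b bP] := @sat_univ_closure _ s (fun rho => model rho (ZF_separation A')).
exists b => x; split=> [/bP[_]|Px].
  move=> /sat_ren /sat_ren h; apply/(AP (fun=> x)).
  move: h; apply: (iffLR (sat_ext _ _ _)) => i; rewrite /mix.
  by case: (odd i); rewrite //= subn1.
apply/bP; split; first exact: Pa.
apply/sat_ren/sat_ren; move/(AP (fun=> x)): Px.
apply: (iffRL (sat_ext _ _ _)) => i; rewrite /mix.
by case: (odd i); rewrite //= subn1.
Qed.

Lemma is_set_im a h : Fun_def h -> Is_set (fun y => exists x, x ∈ a /\ y = h x).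
Proof.
case=> A [s Ah].
(* In [A] the value of [h] is at position 0 and every other even position may hold the argument.
   Replacement expects the argument as variable 0, the value as variable 1, and the parameters after
   them. *)
pose A' := ren (fun i => if odd i then i./2.+2 else if i is 0 then 1 else 0) A.
have A'P x y : sat E (scons x (scons y s)) A' <-> y = h x.
  rewrite sat_ren (Ah (scons y (fun=> x))); apply: sat_ext => -[|[|i]] //.
  by rewrite /mix; case: ifP.
have appE rho d x y : (forall i, rho (d + i) = s i) ->
    sat E rho (pApp A' [:: x; y] d) <->
    sat E (scons (rho (d - x.+1)) (scons (rho (d - y.+1)) s)) A'.
  move=> rho_s; rewrite sat_ren; apply: sat_ext => -[|[|i]] //=.
  by rewrite subSS subSS subn0 rho_s.
have /(_ a)[x _ y z /= []|b bP] :=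
    @sat_univ_closure _ s (fun rho => model rho (ZF_replacement A')).
  (* The numerals are the quantifier depth followed by the levels of argument and value: under [a],
     [x], [y], [z] here, and under [a], [b], [y], [x] in the conclusion of replacement. *)
  move=> /(appE _ 4 1 2 (fun=> erefl))/A'P yh /(appE _ 4 1 3 (fun=> erefl))/A'P zh.
  exact: etrans yh (esym zh).
exists b => y; split=> [/bP[x [xa]]|[x [xa yh]]].
  by move/(appE _ 4 3 2 (fun=> erefl))/A'P; exists x.
by apply/bP; exists x; split=> //; apply/(appE _ 4 3 2 (fun=> erefl))/A'P.
Qed.

(** ** Basic set operations *)

Definition pairS (a b : M) : M := setof (fun x => x = a \/ x = b).
Definition unionS (s : M) : M := setof (fun x => exists a, a ∈ s /\ x ∈ a).
Definition sepS (a : M) (P : M -> Prop) : M := setof (fun x => x ∈ a /\ P x).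
Definition imS (a : M) (h : M -> M) : M := setof (fun y => exists x, x ∈ a /\ y = h x).
Definition emptyS : M := setof (fun=> False).
Definition adjS (a x : M) : M := setof (fun z => z ∈ a \/ z = x).
Definition opairS (a b : M) : M := pairS (pairS a a) (pairS a b).
(* The element of a that satisfies P, when there is exactly one. *)
Definition theS (a : M) (P : M -> Prop) : M := unionS (sepS a P).
Definition delS (a x : M) : M := sepS a (fun z => z <> x).

Lemma is_set_pair a b : Is_set (fun x => x = a \/ x = b).
Proof. by move: a b; apply: (model (fun=> m0) ZF_pairing). Qed.

Lemma is_set_union s : Is_set (fun x => exists a, a ∈ s /\ x ∈ a).
Proof. by move: s; apply: (model (fun=> m0) ZF_union). Qed.

Lemma is_set_sep a P : Def1 P -> Is_set (fun x => x ∈ a /\ P x).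
Proof.
by move=> DP; apply: (@is_set_sub a) => [x []|] //; definable.
Qed.

Lemma is_set_empty : Is_set (fun=> False).
Proof. by apply: (@is_set_sub m0) => //; definable. Qed.

Lemma in_pair a b x : x ∈ pairS a b <-> x = a \/ x = b.
Proof. exact: setofP (is_set_pair a b) x. Qed.

Lemma in_union s x : x ∈ unionS s <-> exists a, a ∈ s /\ x ∈ a.
Proof. exact: setofP (is_set_union s) x. Qed.

Lemma is_set_adj a x : Is_set (fun z => z ∈ a \/ z = x).
Proof.
exists (unionS (pairS a (pairS x x))) => z; rewrite in_union; split=> [[b []]|].
  by rewrite in_pair => -[->|->]; [left|rewrite in_pair; right; tauto].
case=> [za|->]; first by exists a; rewrite in_pair; split=> //; left.
by exists (pairS x x); rewrite !in_pair; split; [right|left].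
Qed.

Lemma in_sep a P x : Def1 P -> x ∈ sepS a P <-> x ∈ a /\ P x.
Proof. by move=> DP; apply: (setofP (is_set_sep a DP)). Qed.

Lemma in_im a h y : Fun_def h -> y ∈ imS a h <-> exists x, x ∈ a /\ y = h x.
Proof. by move=> Dh; apply: (setofP (is_set_im a Dh)). Qed.

Lemma in_empty x : ~ x ∈ emptyS.
Proof. by move=> /(setofP is_set_empty). Qed.

Lemma in_adj a x z : z ∈ adjS a x <-> z ∈ a \/ z = x.
Proof. exact: setofP (is_set_adj a x) z. Qed.

Lemma in_del a x z : z ∈ delS a x <-> z ∈ a /\ z <> x.
Proof. by apply: in_sep; definable. Qed.

Lemma DefT_pair a b : DefT a -> DefT b -> DefT (fun rho => pairS (a rho) (b rho)).
Proof.
move=> Da Db; apply: (DefT_setof (P := fun x rho => x = a rho \/ x = b rho)).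
  by move=> rho; apply: is_set_pair.
by definable.
Qed.

Lemma DefT_union s : DefT s -> DefT (fun rho => unionS (s rho)).
Proof.
move=> Ds; apply: (DefT_setof (P := fun x rho => exists a, a ∈ s rho /\ x ∈ a)).
  by move=> rho; apply: is_set_union.
by definable.
Qed.

Lemma DefT_adj a b : DefT a -> DefT b -> DefT (fun rho => adjS (a rho) (b rho)).
Proof.
move=> Da Db; apply: (DefT_setof (P := fun x rho => x ∈ a rho \/ x = b rho)).
  by move=> rho; apply: is_set_adj.
by definable.
Qed.

Lemma DefT_sep a (P : M -> (nat -> M) -> Prop) :
  DefT a -> Def (fun rho => P (rho 0) (fun i => rho i.+1)) ->
  DefT (fun rho => sepS (a rho) (fun x => P x rho)).
Proof.
move=> Da DP; apply: (DefT_setof (P := fun x rho => x ∈ a rho /\ P x rho)).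
  by move=> rho; apply: is_set_sep; apply: Def_fix.
by definable.
Qed.

Lemma DefT_im a (h : M -> (nat -> M) -> M) :
  DefT a -> DefT (fun rho => h (rho 0) (fun i => rho i.+1)) ->
  DefT (fun rho => imS (a rho) (fun x => h x rho)).
Proof.
move=> Da Dh.
apply: (DefT_setof (P := fun y rho => exists x, x ∈ a rho /\ y = h x rho)).
  move=> rho; apply: is_set_im.
  exact: (Def_subst (fun i => if i is j.+2 then inr (rho j) else inl i) Dh).
apply: (Def_ex (P := fun x rho => x ∈ a (fun i => rho i.+1) /\ rho 0 = h x (fun i => rho i.+1))).
apply: Def_and; first by definable.
apply: Def_eq; first exact: DefT_var.
exact: (DefT_ren (fun i => if i is j.+1 then j.+2 else 0) Dh).
Qed.

Ltac def_hook ::=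
  first [ apply DefT_pair | apply DefT_adj | apply DefT_sep | apply DefT_im
        | apply DefT_union ].

Lemma is_pairE p a b : Is_pair p a b <-> p = pairS a b.
Proof.
split=> [h|-> x]; last exact: in_pair.
by apply: ext => x; rewrite h in_pair.
Qed.

Lemma is_opairE p a b : Is_opair p a b <-> p = opairS a b.
Proof.
split=> [[s [t [/is_pairE-> [/is_pairE-> /is_pairE->]]]]//|->].
by exists (pairS a a), (pairS a b); rewrite !is_pairE.
Qed.

Lemma opair_inE a b r : Opair_in a b r <-> opairS a b ∈ r.
Proof.
split=> [[p [/is_opairE->]]//|abr]; by exists (opairS a b); split=> //; apply/is_opairE.
Qed.

Lemma pair_eq a b c : pairS a b = pairS a c -> b = c.
Proof.
move=> eq_bc.
have /in_pair[ba|//] : b ∈ pairS a c by rewrite -eq_bc in_pair; right.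
have /in_pair[ca|//] : c ∈ pairS a b by rewrite eq_bc in_pair; right.
by rewrite ba ca.
Qed.

Lemma opair_inj a b c d : opairS a b = opairS c d -> a = c /\ b = d.
Proof.
move=> eq_op.
have ac : a = c.
  have : pairS c c ∈ opairS a b by rewrite eq_op in_pair; left.
  rewrite in_pair => -[] eq_c.
    have : a ∈ pairS c c by rewrite eq_c in_pair; left.
    by rewrite in_pair => -[].
  have : a ∈ pairS c c by rewrite eq_c in_pair; left.
  by rewrite in_pair => -[].
split=> //; move: eq_op; rewrite ac => /pair_eq; exact: pair_eq.
Qed.

Lemma theSP a P y : Def1 P -> y ∈ a -> P y ->
  (forall z, z ∈ a -> P z -> z = y) -> theS a P = y.
Proof.
move=> DP ya Py uniq_y; apply: ext => x; rewrite in_union; split=> [[b []]|xy].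
  by rewrite in_sep // => -[ba Pb]; rewrite (uniq_y _ ba Pb).
by exists y; rewrite in_sep.
Qed.

(** ** Functions and equipotence *)

(** Definability belongs to the notion: by replacement such a map has a set as its graph on [a], and
    conversely a function of the model acts through [appS], which is definable. *)
Definition Bij (h : M -> M) (a b : M) : Prop :=
  [/\ Fun_def h, forall x, x ∈ a -> h x ∈ b,
      forall x y, x ∈ a -> y ∈ a -> h x = h y -> x = y
    & forall y, y ∈ b -> exists x, x ∈ a /\ h x = y].

Definition appS (f b x : M) : M := theS b (fun y => opairS x y ∈ f).

Lemma app_def f b : Fun_def (appS f b).
Proof. by rewrite /appS /theS; definable. Qed.

Lemma appP f a b x : Is_fun f a b -> x ∈ a ->
  appS f b x ∈ b /\ forall y, opairS x y ∈ f <-> y = appS f b x.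
Proof.
case=> rel_f fun_f xa; have [y [/opair_inE xyf uniq_y]] := fun_f x xa.
have [x' [_ [y' [yb /is_opairE/opair_inj[_ yy']]]]] := rel_f _ xyf.
have -> : appS f b x = y.
  apply: theSP => //; [by definable|by rewrite yy'|].
  by move=> z _ xzf; apply/uniq_y/opair_inE.
split=> [|z]; first by rewrite yy'.
by split=> [xzf|->//]; apply/uniq_y/opair_inE.
Qed.

Lemma equipotentE a b : Equipotent a b <-> exists h, Bij h a b.
Proof.
split=> [[f [fun_f [inj_f surj_f]]]|[h [Dh hab inj_h surj_h]]].
  exists (appS f b); split=> [|x xa|x y xa ya eq_xy|y yb].
  - exact: app_def.
  - exact: (appP fun_f xa).1.
  - have [_ fx] := appP fun_f xa; have [_ fy] := appP fun_f ya.
    by apply: (inj_f x y (appS f b x)); split; apply/opair_inE; [apply/fx|apply/fy].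
  - have [x /opair_inE xyf] := surj_f y yb.
    have [x' [xa [y' [_ /is_opairE/opair_inj[xx' _]]]]] := fun_f.1 _ xyf.
    rewrite -xx' in xa; exists x; split=> //.
    by have [_ fx] := appP fun_f xa; apply/esym/fx.
pose f := imS a (fun x => opairS x (h x)).
have Df : Fun_def (fun x => opairS x (h x)) by definable.
have fP x y : Opair_in x y f <-> x ∈ a /\ y = h x.
  rewrite opair_inE in_im //; split=> [[x' [x'a]]|[xa ->]]; last by exists x.
  by move=> /opair_inj[-> ->].
exists f; split; first split.
- move=> p; rewrite in_im // => -[x [xa ->]]; exists x; split=> //; exists (h x).
  by split; [apply: hab|apply/is_opairE].
- move=> x xa; exists (h x); split; first by apply/fP.
  by move=> z /fP[].
split=> [x y z [/fP[xa ->] /fP[ya]]|y yb]; first exact: inj_h.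
by have [x [xa <-]] := surj_h y yb; exists x; apply/fP.
Qed.

Lemma equip_refl a : Equipotent a a.
Proof. by apply/equipotentE; exists id; split=> // [|y ya]; [definable|exists y]. Qed.

(** Preimages under a bijection are unique, so [theS] names them and the inverse is definable
    without choice. *)
Lemma equip_sym a b : Equipotent a b -> Equipotent b a.
Proof.
move=> /equipotentE[h [Dh hab inj_h surj_h]]; apply/equipotentE.
exists (fun y => theS a (fun x => h x = y)).
have invK x : x ∈ a -> theS a (fun z => h z = h x) = x.
  by move=> xa; apply: theSP => // [|z za]; [definable|apply: inj_h].
split=> [|y yb|y z yb zb|x xa].
- by rewrite /theS; definable.
- by have [x [xa <-]] := surj_h y yb; rewrite invK.
- have [x [xa <-]] := surj_h y yb; have [x' [x'a <-]] := surj_h z zb.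
  by rewrite !invK // => ->.
- by exists (h x); split; [apply: hab|apply: invK].
Qed.

Lemma equip_trans b a c : Equipotent a b -> Equipotent b c -> Equipotent a c.
Proof.
move=> /equipotentE[h [Dh hab inj_h surj_h]] /equipotentE[k [Dk kbc inj_k surj_k]].
apply/equipotentE; exists (fun x => k (h x)); split=> [|x xa|x y xa ya eq_xy|z zc].
- by definable.
- exact/kbc/hab.
- by apply: inj_h => //; apply: inj_k => //; apply: hab.
- have [y [yb <-]] := surj_k z zc; have [x [xa <-]] := surj_h y yb.
  by exists x.
Qed.

Lemma equip_im a h : Fun_def h -> (forall x y, x ∈ a -> y ∈ a -> h x = h y -> x = y) ->
  Equipotent a (imS a h).
Proof.
move=> Dh inj_h; apply/equipotentE; exists h; split=> // [x xa|y /(in_im a y Dh)[x [xa ->]]].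
  by rewrite in_im //; exists x.
by exists x.
Qed.

Lemma equip_del a b x y : Equipotent a b -> x ∈ a -> y ∈ b -> Equipotent (delS a x) (delS b y).
Proof.
move=> /equipotentE[h [Dh hab inj_h surj_h]] xa yb; apply/equipotentE.
(* The preimage of [y] loses its value and takes over [h x], the value set free by removing [x]. *)
exists (fun u => if excluded_middle_informative (h u = y) then h x else h u).
split=> [|u|u v|z].
- by definable.
- rewrite !in_del => -[ua ux]; case: excluded_middle_informative => huy.
    by split; [apply: hab|move=> hxy; apply: ux; apply: inj_h => //; rewrite huy].
  by split; [apply: hab|].
- rewrite !in_del => -[ua ux] [va vx].
  case: excluded_middle_informative => huy; case: excluded_middle_informative => hvy.
  + by move=> _; apply: inj_h => //; rewrite huy.
  + by move=> /(inj_h _ _ xa va) /esym.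
  + by move=> /(inj_h _ _ ua xa).
  + exact: inj_h.
- rewrite in_del => -[/surj_h[u [ua huz]] zy].
  case: (classic (u = x)) => [ux|ux]; last first.
    exists u; rewrite in_del; split=> //.
    by case: excluded_middle_informative => // huy; case: zy; rewrite -huz.
  have [v [va hvy]] := surj_h y yb; exists v; rewrite in_del; split.
    by split=> // vx; apply: zy; rewrite -huz ux -vx.
  by case: excluded_middle_informative => // ?; rewrite -ux.
Qed.

Lemma equip_adj a b x y : Equipotent a b -> ~ x ∈ a -> ~ y ∈ b ->
  Equipotent (adjS a x) (adjS b y).
Proof.
move=> /equipotentE[h [Dh hab inj_h surj_h]] xa yb; apply/equipotentE.
exists (fun u => if excluded_middle_informative (u = x) then y else h u).
split=> [|u|u v|z].
- by definable.
- rewrite !in_adj; case: excluded_middle_informative => [ux _|ux [/hab|//]]; first by right.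
  by left.
- rewrite !in_adj.
  case: excluded_middle_informative => [ux|ux];
    case: excluded_middle_informative => [vx|vx] /=.
  + by rewrite ux vx.
  + by move=> _ [va|//] yv; case: yb; rewrite yv; apply: hab.
  + by move=> [ua|//] _ yu; case: yb; rewrite -yu; apply: hab.
  + by move=> [ua|//] [va|//]; apply: inj_h.
- rewrite in_adj => -[/surj_h[u [ua <-]]|->].
    exists u; rewrite in_adj; split; first by left.
    by case: excluded_middle_informative => // ux; case: xa; rewrite -ux.
  exists x; rewrite in_adj; split; first by right.
  by case: excluded_middle_informative.
Qed.

Lemma adj_del a x : x ∈ a -> adjS (delS a x) x = a.
Proof.
move=> xa; apply: ext => z; rewrite in_adj in_del; split=> [[[]|->]//|za].
by case: (classic (z = x)); [right|left].
Qed.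

Lemma del_adj a x : ~ x ∈ a -> delS (adjS a x) x = a.
Proof.
move=> xa; apply: ext => z; rewrite in_del in_adj; split=> [[[]]//|za].
by split; [left|move=> zx; apply: xa; rewrite -zx].
Qed.

(** ** Natural numbers *)

Definition omegaS : M := setof (fun x => forall v, Inductive_set v -> x ∈ v).

Lemma is_emptyE e : Is_empty e <-> e = emptyS.
Proof.
split=> [e0|->]; last exact: in_empty.
by apply: ext => x; split=> [/e0|/in_empty].
Qed.

Lemma is_succE y x : Is_succ y x <-> y = adjS x x.
Proof.
split=> [h|-> z]; last exact: in_adj.
by apply: ext => z; rewrite h in_adj.
Qed.

Lemma inductiveE v :
  Inductive_set v <-> emptyS ∈ v /\ forall x, x ∈ v -> adjS x x ∈ v.
Proof.
split=> [[[e [ev /is_emptyE e0]] sv]|[ev sv]].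
  by split=> [|x /sv[y [yv /is_succE <-]]]; rewrite -?e0.
by split=> [|x /sv xv]; [exists emptyS; rewrite is_emptyE|exists (adjS x x); rewrite is_succE].
Qed.

Lemma in_omega x : x ∈ omegaS <-> forall v, Inductive_set v -> x ∈ v.
Proof.
apply: setofP; have [w ind_w] := model (fun=> m0) ZF_infinity.
apply: (@is_set_sub w) => [y|]; first exact.
by definable.
Qed.

Lemma omega0 : emptyS ∈ omegaS.
Proof. by rewrite in_omega => v /inductiveE[]. Qed.

Lemma omegaS_succ n : n ∈ omegaS -> adjS n n ∈ omegaS.
Proof. by rewrite !in_omega => nw v ind_v; have /inductiveE[_] := ind_v; apply; apply: nw. Qed.

Lemma is_omegaE w : Is_omega w <-> w = omegaS.
Proof.
have omega_ind : Inductive_set omegaS.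
  by apply/inductiveE; split; [apply: omega0|apply: omegaS_succ].
split=> [[ind_w sub_w]|->].
  by apply: ext => x; split=> [/sub_w|]; [apply|rewrite in_omega; apply].
by split=> // v ind_v x; rewrite in_omega; apply.
Qed.

Lemma finiteE a : Finite a <-> exists n, n ∈ omegaS /\ Equipotent a n.
Proof.
split=> [[w [/is_omegaE->]]//|h].
by exists omegaS; split=> //; apply/is_omegaE.
Qed.

Lemma denumerableE a : Denumerable a <-> Equipotent a omegaS.
Proof.
split=> [[w [/is_omegaE->]]//|h].
by exists omegaS; split=> //; apply/is_omegaE.
Qed.

Lemma omega_ind P : Def1 P -> P emptyS ->
  (forall n, n ∈ omegaS -> P n -> P (adjS n n)) -> forall n, n ∈ omegaS -> P n.
Proof.
move=> DP P0 PS n /in_omega /(_ (sepS omegaS P)); rewrite in_sep // => -[] //.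
apply/inductiveE; rewrite in_sep //; split=> [|m]; first by split=> //; apply: omega0.
by rewrite !in_sep // => -[mw Pm]; split; [apply: omegaS_succ|apply: PS].
Qed.

Lemma mem_irrefl x : ~ x ∈ x.
Proof.
move=> xx; have [|y []] := @foundation (pairS x x); first by exists x; rewrite in_pair; left.
move=> yx; have -> : y = x by move/in_pair: yx => -[].
by case; exists x; split=> //; apply/in_pair; left.
Qed.

Lemma omega_trans n m k : n ∈ omegaS -> m ∈ n -> k ∈ m -> k ∈ n.
Proof.
move=> nw; move: n nw m k; apply: omega_ind; first by definable.
  by move=> m k /in_empty.
by move=> n nw IHn m k; rewrite !in_adj => -[/IHn h /h|-> ]; left.
Qed.

Lemma omega_case n : n ∈ omegaS -> n = emptyS \/ exists m, m ∈ omegaS /\ n = adjS m m.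
Proof.
move: n; apply: omega_ind; [by definable|by left|].
by move=> n nw _; right; exists n.
Qed.

Lemma omega_succ_le n m : m ∈ omegaS -> n ∈ m -> adjS n n = m \/ adjS n n ∈ m.
Proof.
move=> mw; move: m mw n; apply: omega_ind; first by definable.
  by move=> n /in_empty.
move=> m mw IHm n; rewrite in_adj => -[/IHm[->|h]|->]; last by left.
  by right; rewrite in_adj; right.
by right; rewrite in_adj; left.
Qed.

Lemma omega_total m n : m ∈ omegaS -> n ∈ omegaS -> m ∈ n \/ m = n \/ n ∈ m.
Proof.
move=> mw nw; move: n nw m mw; apply: omega_ind; first by definable.
  apply: omega_ind; [by definable|by right; left|].
  by move=> m mw [/in_empty//|[->|h]]; right; right; rewrite in_adj; [right|left].
move=> n nw IHn m mw; have [h|[->|/(omega_succ_le mw)[->|h]]] := IHn m mw.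
- by left; rewrite in_adj; left.
- by left; rewrite in_adj; right.
- by right; left.
- by right; right.
Qed.

Lemma def_equip : Rel_def Equipotent.
Proof. by definable. Qed.

(** ** Finite and denumerable sets *)

Lemma equip_omega_inj n m : n ∈ omegaS -> m ∈ omegaS -> Equipotent n m -> n = m.
Proof.
move=> nw; move: n nw m.
have De := def_equip; apply: omega_ind; first by definable.
  move=> m _ /equip_sym/equipotentE[h [_ hab _ _]].
  by apply: ext => x; split=> [/in_empty|/hab /in_empty].
move=> n nw IHn m mw eq_nm; have n_in : n ∈ adjS n n by rewrite in_adj; right.
have [m0'|[k [kw mk]]] := omega_case mw.
  by have /equipotentE[h [_ /(_ _ n_in)]] := eq_nm; rewrite m0' => /in_empty.
have k_in : k ∈ m by rewrite mk in_adj; right.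
have := equip_del eq_nm n_in k_in; rewrite mk !del_adj; try exact: mem_irrefl.
by move=> /(IHn _ kw) ->.
Qed.

Lemma def_finite : Def1 Finite.
Proof.
have De := def_equip.
apply: (@Def_ext (fun rho => exists n, n ∈ omegaS /\ Equipotent (rho 0) n)).
  by move=> rho; rewrite finiteE.
by definable.
Qed.

Lemma finite_empty : Finite emptyS.
Proof. by apply/finiteE; exists emptyS; split; [apply: omega0|apply: equip_refl]. Qed.

Lemma finite_adj a x : Finite a -> Finite (adjS a x).
Proof.
move=> fin_a; case: (classic (x ∈ a)) => xa.
  have -> // : adjS a x = a.
  by apply: ext => z; rewrite in_adj; split=> [[//|->//]|]; left.
have /finiteE[n [nw eq_an]] := fin_a.
apply/finiteE; exists (adjS n n); split; first exact: omegaS_succ.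
by apply: equip_adj => //; apply: mem_irrefl.
Qed.

Lemma finite_ind P : Def1 P -> P emptyS ->
  (forall a x, Finite a -> ~ x ∈ a -> P a -> P (adjS a x)) -> forall a, Finite a -> P a.
Proof.
move=> DP P0 Padj a /finiteE[n [nw eq_an]]; move: n nw a eq_an.
have De := def_equip; apply: omega_ind; first by definable.
  move=> a /equipotentE[h [_ hab _ _]].
  suff -> : a = emptyS by [].
  by apply: ext => x; split=> [/hab /in_empty|/in_empty].
move=> n nw IHn a eq_an.
have /equip_sym/equipotentE[h [_ hna _ _]] := eq_an.
have xa : h n ∈ a by apply: hna; rewrite in_adj; right.
have n_in : n ∈ adjS n n by rewrite in_adj; right.
have := equip_del eq_an xa n_in; rewrite del_adj; last exact: mem_irrefl.
move=> eq_dn; rewrite -(adj_del xa); apply: Padj.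
- by apply/finiteE; exists n.
- by rewrite in_del => -[].
- exact: IHn.
Qed.

Lemma finite_sub b a : Finite b -> Sub a b -> Finite a.
Proof.
move=> fin_b; move: b fin_b a; have Df := def_finite; apply: finite_ind.
- by definable.
- move=> a a0; suff -> : a = emptyS by apply: finite_empty.
  by apply: ext => x; split=> [/a0|/in_empty].
- move=> b x _ _ IHb a ab.
  have fin_d : Finite (delS a x).
    by apply: IHb => z; rewrite in_del => -[/ab]; rewrite in_adj => -[].
  case: (classic (x ∈ a)) => xa; first by rewrite -(adj_del xa); apply: finite_adj.
  apply: IHb => z za; have /in_adj[//|zx] := ab z za.
  by case: xa; rewrite -zx.
Qed.

Lemma finite_im a h : Fun_def h -> Finite a -> Finite (imS a h).
Proof.
move=> Dh; move: a; have Df := def_finite; apply: finite_ind.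
- by definable.
- have -> : imS emptyS h = emptyS.
    by apply: ext => y; rewrite in_im //; split=> [[x [/in_empty]]|/in_empty].
  exact: finite_empty.
- move=> a x _ _ fin_im; have -> : imS (adjS a x) h = adjS (imS a h) (h x).
    apply: ext => y; rewrite in_adj !in_im //; split=> [[z []]|].
      by rewrite in_adj => -[za|->] ->; [left; exists z|right].
    by case=> [[z [za ->]]|->]; [exists z|exists x]; rewrite in_adj; split=> //; [left|right].
  exact: finite_adj.
Qed.

Lemma equip_finite a b : Equipotent a b -> Finite b -> Finite a.
Proof.
move=> eq_ab /finiteE[n [nw eq_bn]]; apply/finiteE; exists n; split=> //.
exact: equip_trans eq_bn.
Qed.

(** * Linear orders and maxima of finite sets *)

Definition Order (R : M -> M -> Prop) (S : M) : Prop :=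
  [/\ Rel_def R, forall x, x ∈ S -> ~ R x x,
      forall x y z, x ∈ S -> y ∈ S -> z ∈ S -> R x y -> R y z -> R x z
    & forall x y, x ∈ S -> y ∈ S -> R x y \/ x = y \/ R y x].

Lemma order_sub R S S' : Sub S' S -> Order R S -> Order R S'.
Proof.
move=> sub_S [DR irr tr tot].
split=> // [x /sub_S/irr//|x y z|x y /sub_S Sx /sub_S]; last exact: tot.
by move=> /sub_S Sx /sub_S Sy /sub_S; apply: tr.
Qed.

Lemma order_flip R S : Order R S -> Order (fun x y => R y x) S.
Proof.
case=> DR irr tr tot; split=> // [|x y z Sx Sy Sz Ryx Rzy|x y Sx Sy].
- by definable.
- exact: tr Rzy Ryx.
- by case: (tot y x Sy Sx) => [|[->|]]; tauto.
Qed.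

Lemma finite_max R S a : Order R S -> Finite a -> Sub a S -> Nonempty a ->
  exists m, m ∈ a /\ forall x, x ∈ a -> x = m \/ R x m.
Proof.
case=> DR _ tr tot; move: a; apply: finite_ind.
- by definable.
- by move=> _ [x /in_empty].
move=> a x _ _ IHa sub_a _.
have Sx : x ∈ S by apply: sub_a; rewrite in_adj; right.
have sub_aS : Sub a S by move=> z za; apply: sub_a; rewrite in_adj; left.
case: (classic (Nonempty a)) => [ne_a|e_a]; last first.
  exists x; split=> [|z]; rewrite in_adj; first by right.
  by case=> [za|]; [case: e_a; exists z|left].
have [m [ma maxm]] := IHa sub_aS ne_a; have Sm := sub_aS m ma.
have [xm|mx] : (R x m \/ x = m) \/ R m x by have := tot x m Sx Sm; tauto.
  exists m; split=> [|z]; rewrite in_adj; first by left.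
  by case=> [/maxm//|->]; tauto.
exists x; split=> [|z]; rewrite in_adj; first by right.
case=> [za|->]; [right|by left]; have [->//|zm] := maxm z za.
exact: tr (sub_aS z za) Sm Sx zm mx.
Qed.

Lemma omega_order : Order (fun x y => x ∈ y) omegaS.
Proof.
split=> [|x _|x y z _ _ zw xy yz|x y].
- by definable.
- exact: mem_irrefl.
- exact: omega_trans yz xy.
- exact: omega_total.
Qed.

Lemma omega_infinite : ~ Finite omegaS.
Proof.
move=> /(finite_max omega_order)[//||m [mw max_m]]; first by exists emptyS; apply: omega0.
have mm : m ∈ adjS m m by rewrite in_adj; right.
have [eq_m|mSm] := max_m _ (omegaS_succ mw); first by apply: (@mem_irrefl m); rewrite -{2}eq_m.
exact: (@mem_irrefl m (omega_trans mw mSm mm)).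
Qed.

Lemma denumerable_infinite a : Denumerable a -> ~ Finite a.
Proof.
move=> /denumerableE/equip_sym eq_a /(equip_finite eq_a); exact: omega_infinite.
Qed.

(** * Enumeration of an infinite linear order with finite initial segments *)

Section Enumeration.

Variables (R : M -> M -> Prop) (S : M).
Hypothesis orderR : Order R S.
Let seg (x : M) : M := sepS S (fun y => R y x).
Hypothesis seg_finite : forall x, x ∈ S -> Finite (seg x).
Hypothesis S_infinite : ~ Finite S.

Let defR : Rel_def R := let: And4 d _ _ _ := orderR in d.

Lemma in_seg x y : y ∈ seg x <-> y ∈ S /\ R y x.
Proof. by apply: in_sep; definable. Qed.

Lemma seg_inj x y : x ∈ S -> y ∈ S -> seg x = seg y -> x = y.
Proof.
have [_ irr _ tot] := orderR => Sx Sy eq_seg.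
have [xy|[//|yx]] := tot x y Sx Sy.
  by have /in_seg[_ /irr[]] : x ∈ seg x by rewrite eq_seg in_seg.
by have /in_seg[_ /irr[]] : y ∈ seg y by rewrite -eq_seg in_seg.
Qed.

Lemma seg_next x : x ∈ S -> exists y, y ∈ S /\ seg y = adjS (seg x) x.
Proof.
have [_ irr tr tot] := orderR => Sx.
have [y [Sy xy]] : exists y, y ∈ S /\ R x y.
  apply: NNPP => no_y; apply: S_infinite.
  apply: (finite_sub (finite_adj x (seg_finite Sx))) => y Sy.
  rewrite in_adj in_seg; have [yx|[->|xy]] := tot y x Sy Sx; [by left|by right|].
  by case: no_y; exists y.
(* [b] is the interval (x, y], finite since it lies in the segment of [y] with [y] added. Its least
   element, found as a maximum for the converse order, is the successor of [x]. *)
pose b := sepS (adjS (seg y) y) (fun z => R x z).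
have in_b z : z ∈ b <-> z ∈ S /\ (R z y \/ z = y) /\ R x z.
  rewrite in_sep ?in_adj ?in_seg; last by definable.
  by split=> [[[[]|->]]|[Sz [[zy|->] xz]]]; tauto.
have fin_b : Finite b.
  apply: finite_sub (finite_adj y (seg_finite Sy)) _ => z.
  by rewrite in_b in_adj in_seg; tauto.
have sub_b : Sub b S by move=> z /in_b[].
have [m [mb min_m]] : exists m, m ∈ b /\ forall z, z ∈ b -> z = m \/ R m z.
  apply: (finite_max (order_flip orderR) fin_b sub_b).
  by exists y; apply/in_b; split=> //; split=> //; right.
have /in_b[Sm [my xm]] := mb; exists m; split=> //; apply: ext => z.
rewrite in_adj !in_seg; split=> [[Sz zm]|[[Sz zx]|->]]; last by split.
  have [zx|[->|xz]] := tot z x Sz Sx; [by left|by right|].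
  have zb : z ∈ b.
    apply/in_b; split=> //; split=> //; left.
    by case: my => [my|<-//]; apply: tr zm my.
  case: (irr m Sm); have [eq_zm|mz] := min_m z zb; first by rewrite -{1}eq_zm.
  exact: tr mz zm.
by split=> //; apply: tr zx xm.
Qed.

(** Uniqueness is carried through the induction because it allows [theS] to name the element of a
    given rank. *)
Lemma rank_exists n : n ∈ omegaS -> exists x, x ∈ S /\ Equipotent (seg x) n /\
  forall y, y ∈ S -> Equipotent (seg y) n -> y = x.
Proof.
have [_ irr tr tot] := orderR; have De := def_equip.
move: n; apply: omega_ind; first by rewrite /seg; definable.
  have [x0 Sx0] : Nonempty S.
    apply: NNPP => S0; apply: S_infinite; apply: (finite_sub finite_empty) => x Sx.
    by case: S0; exists x.
  (* The least element of [S] is sought among the finitely many elements up to an arbitrary [x0]. *)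
  pose b := adjS (seg x0) x0.
  have sub_b : Sub b S by move=> z; rewrite in_adj in_seg => -[[]|->].
  have [m [mb min_m]] : exists m, m ∈ b /\ forall z, z ∈ b -> z = m \/ R m z.
    apply: (finite_max (order_flip orderR) _ sub_b); first exact/finite_adj/seg_finite.
    by exists x0; rewrite in_adj; right.
  have Sm := sub_b m mb.
  have seg0 : seg m = emptyS.
    apply: ext => z; split=> [/in_seg[Sz zm]|/in_empty//].
    have zb : z ∈ b.
      rewrite in_adj in_seg; move: mb; rewrite in_adj in_seg => -[[_ mx0]|mx0]; left; split=> //.
        exact: tr zm mx0.
      by rewrite -mx0.
    case: (irr m Sm); have [eq_zm|mz] := min_m z zb; first by rewrite -{1}eq_zm.
    exact: tr mz zm.
  exists m; split=> //; split; first by rewrite seg0; apply: equip_refl.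
  move=> y Sy /equipotentE[h [_ hab _ _]]; apply: seg_inj => //; rewrite seg0.
  by apply: ext => z; split=> [/hab /in_empty|/in_empty].
move=> n nw [x [Sx [eq_x uniq_x]]]; have [x' [Sx' seg_x']] := seg_next Sx.
exists x'; split=> //; split.
  rewrite seg_x'; apply: equip_adj => //; last exact: mem_irrefl.
  by rewrite in_seg => -[_]; apply: irr.
move=> y Sy eq_y; apply: seg_inj => //; rewrite seg_x'.
have n_in : n ∈ adjS n n by rewrite in_adj; right.
(* An element with n + 1 predecessors is the successor of its greatest predecessor [m]; the latter
   has n predecessors and is therefore [x]. *)
have [m [my max_m]] : exists m, m ∈ seg y /\ forall z, z ∈ seg y -> z = m \/ R z m.
  apply: (finite_max orderR (seg_finite Sy)); first by move=> z /in_seg[].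
  by have /equip_sym/equipotentE[h [_ hab _ _]] := eq_y; exists (h n); apply: hab.
have /in_seg[Sm mRy] := my.
have seg_y : adjS (seg m) m = seg y.
  apply: ext => z; rewrite in_adj !in_seg; split=> [[[Sz zm]|->]|[Sz zy]]; last 1 first.
  - have /max_m[|] : z ∈ seg y by rewrite in_seg.
      by right.
    by left.
  - by split=> //; apply: tr zm mRy.
  - by [].
rewrite -seg_y; suff -> : m = x by [].
apply: uniq_x => //; have := equip_del eq_y my n_in.
rewrite -seg_y !del_adj //; first exact: mem_irrefl.
by rewrite in_seg => -[_]; apply: irr.
Qed.

(* The n-th element of S is the one with n predecessors. *)
Lemma denumerable_order : Denumerable S.
Proof.
have De := def_equip.
apply/denumerableE/equip_sym/equipotentE.
have Dh : Fun_def (fun n => theS S (fun x => Equipotent (seg x) n)).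
  by rewrite /theS /seg; definable.
have hP n : n ∈ omegaS -> theS S (fun x => Equipotent (seg x) n) ∈ S /\
    Equipotent (seg (theS S (fun x => Equipotent (seg x) n))) n.
  move=> /rank_exists[x [Sx [eq_x uniq_x]]].
  have -> : theS S (fun x => Equipotent (seg x) n) = x; last by [].
  by apply: theSP => //; rewrite /seg; definable.
exists (fun n => theS S (fun x => Equipotent (seg x) n)).
split=> // [n /hP[]//|n m nw mw eq_nm|x Sx].
  apply: equip_omega_inj => //; apply: equip_trans (hP m mw).2.
  by rewrite -eq_nm; apply: equip_sym; apply: (hP n nw).2.
have /finiteE[n [nw eq_n]] := seg_finite Sx; exists n; split=> //.
have [x' [_ [_ uniq_x]]] := rank_exists nw.
have [h1 h2] := hP n nw.
by rewrite (uniq_x _ h1 h2) (uniq_x _ Sx eq_n).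
Qed.

End Enumeration.

(** By injectivity a new member of [V] is the value of at most one index, so the bound has to pass
    one more natural number at most. The lemma yields an index beyond any given finite subfamily. *)
Lemma finite_bound h : Fun_def h ->
    (forall n m, n ∈ omegaS -> m ∈ omegaS -> h n = h m -> n = m) ->
  forall V, Finite V -> exists n, n ∈ omegaS /\
    forall m, m ∈ omegaS -> h m ∈ V -> m ∈ n.
Proof.
move=> Dh inj_h; apply: finite_ind; first by definable.
  by exists emptyS; split=> [|m _ /in_empty//]; apply: omega0.
move=> a x _ _ [n [nw bnd_n]].
case: (classic (exists k, k ∈ omegaS /\ h k = x)) => [[k [kw hk]]|no_k]; last first.
  exists n; split=> // m mw; rewrite in_adj => -[/(bnd_n _ mw)//|hm].
  by case: no_k; exists m.
have [i [iw [sub_n ki]]] : exists i, i ∈ omegaS /\ Sub n i /\ k ∈ i.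
  have k_in : k ∈ adjS k k by rewrite in_adj; right.
  have [kn|nk] : k ∈ n \/ (k = n \/ n ∈ k) by have := omega_total kw nw; tauto.
    by exists n; split=> //; split=> // y.
  exists (adjS k k); split; first exact: omegaS_succ.
  split=> // y yn; rewrite in_adj; left.
  by case: nk => [->//|nk]; apply: omega_trans nk yn.
exists i; split=> // m mw; rewrite in_adj => -[/(bnd_n _ mw)/sub_n//|hm].
by rewrite (inj_h m k) // hk.
Qed.

Lemma denumerable_countable a : Denumerable a -> Countable a.
Proof.
by case=> w [w_omega eq_aw]; exists w; split=> //; exists w; split.
Qed.

Lemma denumerable_im h : Fun_def h ->
    (forall n m, n ∈ omegaS -> m ∈ omegaS -> h n = h m -> n = m) ->
  Denumerable (imS omegaS h).
Proof. by move=> Dh inj_h; apply/denumerableE/equip_sym/equip_im. Qed.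

(** ** Locally finite cellular families *)

Section Space.

Variables X T : M.
Hypothesis top : Is_topology X T.

Lemma open_sub U : U ∈ T -> Sub U X.
Proof. by case: top => h _; apply: h. Qed.

(** No neighbourhood is chosen at any point: [W] is the union of all open sets contained in it. *)
Lemma open_local W :
  (forall x, x ∈ W -> exists V, V ∈ T /\ x ∈ V /\ Sub V W) -> W ∈ T.
Proof.
move=> locW; have [_ [_ [_ [_ /(_ (sepS T (fun V => Sub V W)))[|U [UT defU]]]]]] := top.
  by move=> V; rewrite in_sep; [case|definable].
suff <- : U = W by [].
apply: ext => x; rewrite defU; split=> [[V []]|/locW[V [VT [xV VW]]]].
  by rewrite in_sep; [move=> [_ VW] /VW|definable].
by exists V; split=> //; rewrite in_sep //; definable.
Qed.

Lemma not_in_closure A U x : U ∈ T -> x ∈ U -> Sub A X -> ~ Meets U A -> ~ In_closure X T A x.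
Proof.
move=> UT xU AX UA [xX clA].
have DC : Def1 (fun y => ~ y ∈ U) by definable.
have /clA : Is_closed X T (sepS X (fun y => ~ y ∈ U)) /\ Sub A (sepS X (fun y => ~ y ∈ U)).
  split; last first.
    move=> y yA; rewrite in_sep //; split; first exact: AX.
    by move=> yU; apply: UA; exists y.
  split; first by move=> y; rewrite in_sep // => -[].
  exists U; split=> // y; rewrite in_sep //; split=> [yU|[yX yC]].
    by split; [apply: open_sub yU|case].
  by apply: NNPP => yU; apply: yC.
by rewrite in_sep // => -[].
Qed.

Lemma locally_finite_no_cluster F x : Locally_finite X T F -> ~ Cluster_point X T F x.
Proof.
move=> lfF [xX clx]; have [N [nbhdN [G [traceG finG]]]] := lfF x xX.
have [G' [traceG' infG']] := clx N nbhdN.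
suff eqG : G' = G by apply: infG'; rewrite eqG.
by apply: ext => A; rewrite traceG.
Qed.

(** * Failure of (B1) to (B5) in the presence of a locally finite denumerable cellular family *)

Section LocallyFinite.

Variable F : M.
Hypotheses (denF : Denumerable F) (cellF : Cellular T F) (lfF : Locally_finite X T F).

Lemma locally_finite_notB2 : ~ SB2 X T.
Proof.
move=> /(_ F)[|x]; first by split=> //; case: cellF => ? [].
exact: locally_finite_no_cluster.
Qed.

Lemma locally_finite_notB3 : ~ SB3 X T.
Proof. move=> /(_ F)[//|x]; exact: locally_finite_no_cluster. Qed.

Lemma locally_finite_notB5 : ~ SB5 X T.
Proof.
move=> /(_ F) B5F; apply: (denumerable_infinite denF); apply: B5F.
by have [? [_ ?]] := cellF; split; first exact: denumerable_countable.
Qed.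

Variable e : M -> M.
Hypothesis bij_e : Bij e omegaS F.

Let De : Fun_def e := let: And4 d _ _ _ := bij_e in d.

(** For natural numbers, [~ m ∈ n] means that [m] is at least [n]. *)
Definition tail (n : M) : M :=
  sepS X (fun x => exists m, m ∈ omegaS /\ ~ m ∈ n /\ x ∈ e m).
Definition co_tail (n : M) : M :=
  sepS X (fun x => exists V, V ∈ T /\ x ∈ V /\ ~ Meets V (tail n)).

Lemma tail_def : Fun_def tail.
Proof. by rewrite /tail; definable. Qed.

Lemma co_tail_def : Fun_def co_tail.
Proof. by rewrite /co_tail /tail; definable. Qed.

Lemma e_open n : n ∈ omegaS -> e n ∈ T.
Proof. by case: bij_e cellF => _ eF _ _ [FT _] /eF/FT. Qed.

Lemma in_tail n x : x ∈ tail n <-> exists m, m ∈ omegaS /\ ~ m ∈ n /\ x ∈ e m.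
Proof.
rewrite in_sep; last by definable.
split=> [[]//|h]; split=> //; case: h => m [mw [_ xm]].
exact: open_sub (e_open mw) _ xm.
Qed.

Lemma in_co_tail n x :
  x ∈ co_tail n <-> exists V, V ∈ T /\ x ∈ V /\ ~ Meets V (tail n).
Proof.
have Dt := tail_def; rewrite in_sep; last by definable.
split=> [[]//|h]; split=> //; case: h => V [VT [xV _]].
exact: open_sub VT _ xV.
Qed.

Lemma e_disjoint n m x : n ∈ omegaS -> m ∈ omegaS -> x ∈ e n -> x ∈ e m -> n = m.
Proof.
case: bij_e cellF => _ eF inj_e _ [_ [_ disjF]] nw mw xn xm; apply: NNPP => nm.
apply: (disjF _ (eF n nw) _ (eF m mw)) => [/(inj_e _ _ nw mw)//|].
by exists x.
Qed.

Lemma e_nonempty n : n ∈ omegaS -> Nonempty (e n).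
Proof. by case: bij_e cellF => _ eF _ _ [_ [neF _]] /eF/neF. Qed.

Lemma e_sub_tail n : n ∈ omegaS -> Sub (e n) (tail n).
Proof. by move=> nw x xn; apply/in_tail; exists n; split=> //; split=> //; apply: mem_irrefl. Qed.

Lemma e_tail_disjoint n m : n ∈ omegaS -> n ∈ m -> ~ Meets (e n) (tail m).
Proof.
move=> nw nm [x [xn /in_tail[k [kw [km xk]]]]].
by apply: km; rewrite -(e_disjoint nw kw xn xk).
Qed.

Lemma tail_antimono n m : m ∈ omegaS -> n = m \/ n ∈ m -> Sub (tail m) (tail n).
Proof.
move=> mw nm x /in_tail[k [kw [km xk]]]; apply/in_tail; exists k; split=> //; split=> // kn.
by apply: km; case: nm => [<-//|nm]; apply: omega_trans nm kn.
Qed.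

Lemma inj_omega (h : M -> M) :
    (forall n m, n ∈ omegaS -> m ∈ omegaS -> n ∈ m -> h n <> h m) ->
  forall n m, n ∈ omegaS -> m ∈ omegaS -> h n = h m -> n = m.
Proof.
move=> inj_h n m nw mw eq_h; have [nm|[//|mn]] := omega_total nw mw.
  by case: (inj_h n m).
by case: (inj_h m n).
Qed.

(** For [n] below [m], the non-empty set [e n] lies in [tail n] and misses [tail m]. Injectivity is
    what makes the family of tails denumerable. *)
Lemma tail_inj n m : n ∈ omegaS -> m ∈ omegaS -> tail n = tail m -> n = m.
Proof.
move: n m; apply: inj_omega => n m nw mw nm eq_t; have [x xn] := e_nonempty nw.
by apply: (e_tail_disjoint nw nm); exists x; rewrite -eq_t; split=> //; apply: e_sub_tail.
Qed.

Lemma co_tail_inj n m : n ∈ omegaS -> m ∈ omegaS -> co_tail n = co_tail m -> n = m.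
Proof.
move: n m; apply: inj_omega => n m nw mw nm eq_c; have [x xn] := e_nonempty nw.
have : x ∈ co_tail n.
  rewrite eq_c; apply/in_co_tail; exists (e n); split; first exact: e_open.
  by split=> //; apply: e_tail_disjoint.
case/in_co_tail => V [_ [xV]]; apply; exists x; split=> //.
exact: e_sub_tail xn.
Qed.

(** Local finiteness enters here: a neighbourhood of [x] meets finitely many [e m], so an open set
    around [x] misses every tail that starts late enough. The same fact shows that no point adheres
    to all tails. *)
Lemma co_tail_cover x : x ∈ X -> exists n, n ∈ omegaS /\ x ∈ co_tail n.
Proof.
move=> xX; have [N [[NX [U [UT [xU UN]]]] [G [traceG finG]]]] := lfF xX.
have [_ eF inj_e _] := bij_e.
have [n [nw bnd_n]] := finite_bound De inj_e finG.
exists n; split=> //; apply/in_co_tail; exists U; split=> //; split=> // -[z [zU]].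
case/in_tail => m [mw [mn zm]]; apply: mn; apply: bnd_n => //.
by apply/traceG; split; [apply: eF|exists z; split=> //; apply: UN].
Qed.

Lemma locally_finite_notB4_enum : ~ SB4 X T.
Proof.
have Dt := tail_def; move=> /(_ (imS omegaS tail))[|x [xX adh_x]].
  split; first exact/denumerable_countable/denumerable_im/tail_inj.
  split.
    move=> A /(in_im _ _ Dt)[n [nw ->]]; apply: open_local => x /in_tail[m [mw [mn xm]]].
    exists (e m); split; first exact: e_open.
    by split=> // y ym; apply/in_tail; exists m.
  split; first by move=> A /(in_im _ _ Dt)[n [nw ->]] x; rewrite in_sep; [case|definable].
  split.
    move=> A /(in_im _ _ Dt)[n [nw ->]]; have [x xn] := e_nonempty nw; exists x.
    exact: e_sub_tail xn.
  move=> A /(in_im _ _ Dt)[n [nw ->]] B /(in_im _ _ Dt)[m [mw ->]].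
  have [i [iw [ni mi]]] : exists i, i ∈ omegaS /\ (n = i \/ n ∈ i) /\ (m = i \/ m ∈ i).
    by have := omega_total nw mw => -[nm|[nm|nm]];
      [exists m|exists m|exists n]; split=> //; split; tauto.
  exists (tail i); split; first by apply/in_im => //; exists i.
  by move=> x xi; split; apply: tail_antimono xi.
have [n [nw /in_co_tail[V [VT [xV Vt]]]]] := co_tail_cover xX.
apply: (not_in_closure (A := tail n) VT xV) => //.
  by move=> y; rewrite in_sep; [case|definable].
by apply: adh_x; apply/in_im => //; exists n.
Qed.

Lemma locally_finite_notB1_enum : ~ SB1 X T.
Proof.
have Dt := tail_def; have Dc := co_tail_def.
have subX n : Sub (co_tail n) X.
  by move=> y /in_co_tail[V [/open_sub VX [/VX]]].
move=> /(_ (imS omegaS co_tail))[|V [VU [finV covV]]].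
  split; first exact/denumerable_countable/denumerable_im/co_tail_inj.
  split.
    move=> A /(in_im _ _ Dc)[n [nw ->]]; apply: open_local => x /in_co_tail[V [VT [xV Vt]]].
    by exists V; split=> //; split=> // y yV; apply/in_co_tail; exists V.
  move=> x; split=> [/co_tail_cover[n [nw xn]]|[A [/(in_im _ _ Dc)[n [nw ->]]]]].
    by exists (co_tail n); split=> //; apply/in_im => //; exists n.
  exact: subX.
(* All members of the finite subfamily have an index below [n]. The open set [e n] is contained in
   their tails, hence disjoint from these members, and its points are outside their closures. *)
have [n [nw bnd_n]] := finite_bound Dc co_tail_inj finV.
have [x xn] := e_nonempty nw.
have /covV[A [AV]] := open_sub (e_open nw) xn.
have /(in_im _ _ Dc)[m [mw defA]] := VU A AV.
apply: (not_in_closure (e_open nw) xn); first by rewrite defA.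
move=> [y [yn]]; rewrite defA => /in_co_tail[W [WT [yW]]]; apply.
exists y; split=> //; apply/in_tail; exists n; split=> //; split=> // nm.
have mn : m ∈ n by apply: bnd_n => //; rewrite -defA.
exact: (@mem_irrefl n (omega_trans nw mn nm)).
Qed.

End LocallyFinite.

Lemma locally_finite_notB F : Denumerable F -> Cellular T F -> Locally_finite X T F ->
  ~ SB1 X T /\ ~ SB2 X T /\ ~ SB3 X T /\ ~ SB4 X T /\ ~ SB5 X T.
Proof.
move=> denF cellF lfF; have /denumerableE/equip_sym/equipotentE[e bij_e] := denF.
split; first exact: locally_finite_notB1_enum bij_e.
split; first exact: locally_finite_notB2 lfF.
split; first exact: locally_finite_notB3 lfF.
split; first exact: locally_finite_notB4_enum bij_e.
exact: locally_finite_notB5 lfF.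
Qed.

End Space.

(** ** Unbounded functions into an ordered set with a translation *)

Section Slabs.

(** [L] will be the order of the line or its converse, [sigma] a translation in the direction of
    [L], and [tau] the inverse translation. *)
Variables (X T r : M) (L : M -> M -> Prop) (sigma tau g : M -> M).
Hypotheses (orderL : Order L r) (Dsigma : Fun_def sigma) (Dg : Fun_def g).
Hypothesis sigma_r : forall x, x ∈ r -> sigma x ∈ r.
Hypothesis tau_r : forall x, x ∈ r -> tau x ∈ r.
Hypothesis tauK : forall x, x ∈ r -> sigma (tau x) = x.
Hypothesis sigma_mono : forall x y, x ∈ r -> y ∈ r -> L x y -> L (sigma x) (sigma y).
Hypothesis sigma_gt : forall x, x ∈ r -> L x (sigma x).
Hypothesis L_complete : forall s, Sub s r -> Nonempty s ->
  (exists b, b ∈ r /\ forall x, x ∈ s -> L x b \/ x = b) ->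
  exists b, b ∈ r /\ (forall x, x ∈ s -> L x b \/ x = b) /\
    forall c, c ∈ r -> (forall x, x ∈ s -> L x c \/ x = c) -> L b c \/ b = c.
Hypothesis g_r : forall x, x ∈ X -> g x ∈ r.
Hypothesis g_open : forall a b, a ∈ r -> b ∈ r ->
  sepS X (fun x => L a (g x) /\ L (g x) b) ∈ T.
Hypothesis g_unbounded : forall b, b ∈ r -> exists x, x ∈ X /\ L b (g x).

Let defL : Rel_def L := let: And4 d _ _ _ := orderL in d.

Lemma L_irr x : x ∈ r -> ~ L x x.
Proof. by case: orderL => _ irr _ _; apply: irr. Qed.

Lemma L_trans y x z : x ∈ r -> y ∈ r -> z ∈ r -> L x y -> L y z -> L x z.
Proof. by case: orderL => _ _ tr _; apply: tr. Qed.

Lemma L_total x y : x ∈ r -> y ∈ r -> L x y \/ x = y \/ L y x.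
Proof. by case: orderL => _ _ _; apply. Qed.

Lemma sigma_reflect x y : x ∈ r -> y ∈ r -> L (sigma x) (sigma y) -> L x y.
Proof.
move=> rx ry sxy; have [//|[xy|yx]] := L_total rx ry.
  by case: (@L_irr (sigma x)); [apply: sigma_r|rewrite {2}xy].
case: (@L_irr (sigma x)); first exact: sigma_r.
by apply: (L_trans (y := sigma y)) => //; try exact: sigma_r; apply: sigma_mono.
Qed.

(** The set of iterates of [sigma] at [c], a copy of the natural numbers inside [r], given as an
    intersection instead of by recursion. *)
Definition orbit (c : M) : M :=
  sepS r (fun x => forall v, c ∈ v -> (forall y, y ∈ v -> sigma y ∈ v) -> x ∈ v).

Lemma in_orbit c x : x ∈ orbit c <->
  x ∈ r /\ forall v, c ∈ v -> (forall y, y ∈ v -> sigma y ∈ v) -> x ∈ v.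
Proof. by apply: in_sep; definable. Qed.

Lemma orbit_def : Fun_def orbit.
Proof. by rewrite /orbit; definable. Qed.

Lemma orbit_r c x : x ∈ orbit c -> x ∈ r.
Proof. by case/in_orbit. Qed.

(** * One orbit and the slabs between its consecutive points *)

Section Orbit.

Variable c : M.
Hypothesis rc : c ∈ r.

Lemma orbit_start : c ∈ orbit c.
Proof. by apply/in_orbit; split. Qed.

Lemma orbit_step x : x ∈ orbit c -> sigma x ∈ orbit c.
Proof.
case/in_orbit => rx orb_x; apply/in_orbit; split=> [|v vc vs]; first exact: sigma_r.
exact/vs/orb_x.
Qed.

Lemma orbit_ind P : Def1 P -> P c -> (forall d, d ∈ orbit c -> P d -> P (sigma d)) ->
  forall d, d ∈ orbit c -> P d.
Proof.
move=> DP Pc Ps d /in_orbit[_ orb_d].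
suff : d ∈ sepS (orbit c) P by rewrite in_sep // => -[].
apply: orb_d; first by rewrite in_sep //; split=> //; apply: orbit_start.
by move=> y; rewrite !(in_sep _ _ DP) => -[yo Py]; split; [apply: orbit_step|apply: Ps].
Qed.

Lemma orbit_case d : d ∈ orbit c -> d = c \/ exists d', d' ∈ orbit c /\ d = sigma d'.
Proof.
have Do := orbit_def; move: d; apply: orbit_ind; [by definable|by left|].
by move=> d od _; right; exists d.
Qed.

Lemma orbit_min d : d ∈ orbit c -> L c d \/ c = d.
Proof.
move: d; apply: orbit_ind; [by definable|by right|].
move=> d /orbit_r rd cd; left; case: cd => [cd|->]; last exact: sigma_gt.
by apply: L_trans cd (sigma_gt rd) => //; apply: sigma_r.
Qed.

(** Induction on [d], for all [d']: a point [d'] inside the gap is either [c], which is least, or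
    [sigma d1] with [d1] one step lower; this contradicts the minimality of [c] or the induction
    hypothesis. *)
Lemma orbit_gap d d' : d ∈ orbit c -> d' ∈ orbit c -> L d d' -> ~ L d' (sigma d).
Proof.
have Do := orbit_def; move=> od; move: d od d'; apply: orbit_ind; first by definable.
  move=> d' od' cd' d'c; have [d'_c|[d1 [od1 d'1]]] := orbit_case od'.
    by apply: (L_irr rc); rewrite -{2}d'_c.
  move: d'c; rewrite d'1 => /(sigma_reflect (orbit_r od1) rc) d1c.
  case: (orbit_min od1) => [cd1|c1]; last by apply: (L_irr rc); rewrite {1}c1.
  by apply: (L_irr rc); apply: L_trans cd1 d1c => //; apply: orbit_r od1.
move=> d od IHd d' od' sdd' d's; have rd := orbit_r od; have rsd := sigma_r rd.
have [d'_c|[d1 [od1 d'1]]] := orbit_case od'.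
  have csd : L c (sigma d).
    case: (orbit_min od) => [cd|->]; last exact: sigma_gt.
    exact: L_trans cd (sigma_gt rd).
  by apply: (L_irr rc); apply: L_trans csd _ => //; rewrite -d'_c.
have rd1 := orbit_r od1; rewrite d'1 in sdd' d's.
exact: IHd od1 (sigma_reflect rd rd1 sdd') (sigma_reflect rd1 rsd d's).
Qed.

(** If the orbit were bounded with supremum [s], then [tau s], being smaller than [s], would not
    bound it; an orbit point beyond [tau s] is moved beyond [s] by [sigma]. *)
Lemma orbit_archimedean y : y ∈ r -> exists d, d ∈ orbit c /\ L y d.
Proof.
move=> ry; apply: NNPP => no_d.
have [|||s [rs [ub_s lub_s]]] := @L_complete (orbit c).
- by move=> d /orbit_r.
- by exists c; apply: orbit_start.
- exists y; split=> // d od; have [dy|[dy|yd]] := L_total (orbit_r od) ry; [by left|by right|].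
  by case: no_d; exists d.
have rt := tau_r rs; have ts : L (tau s) s by rewrite -{2}(tauK rs); apply: sigma_gt.
have [d [od td]] : exists d, d ∈ orbit c /\ L (tau s) d.
  apply: NNPP => no_td; have [||st|st] := lub_s (tau s) => //.
  - move=> d od; have [dt|[dt|td]] := L_total (orbit_r od) rt; [by left|by right|].
    by case: no_td; exists d.
  - by apply: (L_irr rs); apply: L_trans st ts.
  - by apply: (L_irr rs); rewrite {1}st.
have rd := orbit_r od; have ssd : L s (sigma d) by rewrite -(tauK rs); apply: sigma_mono.
apply: (L_irr rs); have [sds|sds] := ub_s _ (orbit_step od).
  by apply: L_trans ssd sds => //; apply: sigma_r.
by rewrite -{2}sds.
Qed.

(** Induction on an orbit point above [y]. The first alternative, [y] itself a division point, is
    the one that a single orbit cannot handle. *)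
Lemma orbit_floor y : y ∈ r -> L c y ->
  y ∈ orbit c \/ exists d, d ∈ orbit c /\ L d y /\ L y (sigma d).
Proof.
have Do := orbit_def; move=> ry cy; have [e [oe ye]] := orbit_archimedean ry.
move: e oe y ry cy ye; apply: orbit_ind; first by definable.
  by move=> y ry cy yc; case: (L_irr rc); apply: L_trans cy yc.
move=> e oe IHe y ry cy yse; have [ye|[->|ey]] := L_total ry (orbit_r oe).
- exact: IHe.
- by left.
- by right; exists e.
Qed.

(** It suffices to treat an orbit point [e] above [z], by induction on [e]: since gaps are empty,
    the segment below [sigma e] gains at most the point [e]. *)
Lemma orbit_seg_finite z : z ∈ r -> Finite (sepS (orbit c) (fun d => L d z)).
Proof.
have Do := orbit_def; have Df := def_finite.
have in_seg e d : d ∈ sepS (orbit c) (fun d => L d e) <-> d ∈ orbit c /\ L d e.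
  by apply: in_sep; definable.
move=> rz; have [e [oe ze]] := orbit_archimedean rz.
apply: (@finite_sub (sepS (orbit c) (fun d => L d e))); last first.
  move=> d /in_seg[od dz]; apply/in_seg; split=> //.
  exact: L_trans (orbit_r od) rz (orbit_r oe) dz ze.
move: e oe {ze}; apply: orbit_ind; first by definable.
  apply: finite_sub finite_empty _ => d /in_seg[od dc]; case: (L_irr rc).
  have rd := orbit_r od; case: (orbit_min od) => [cd|{1}->//].
  exact: L_trans cd dc.
move=> e oe fin_e; apply: finite_sub (finite_adj e fin_e) _ => d /in_seg[od dse].
apply/in_adj; rewrite in_seg; have [de|[de|ed]] := L_total (orbit_r od) (orbit_r oe).
- by left.
- by right.
- by case: (orbit_gap oe od ed).
Qed.

Definition slab (d : M) : M := sepS X (fun x => L d (g x) /\ L (g x) (sigma d)).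

Lemma in_slab d x : x ∈ slab d <-> x ∈ X /\ L d (g x) /\ L (g x) (sigma d).
Proof. by apply: in_sep; definable. Qed.

Lemma slab_def : Fun_def slab.
Proof. by rewrite /slab; definable. Qed.

Definition slab_index : M := sepS (orbit c) (fun d => Nonempty (slab d)).

Lemma in_slab_index d : d ∈ slab_index <-> d ∈ orbit c /\ Nonempty (slab d).
Proof. by have Ds := slab_def; apply: in_sep; definable. Qed.

Lemma slab_disjoint d d' x : d ∈ orbit c -> d' ∈ orbit c ->
  x ∈ slab d -> x ∈ slab d' -> d = d'.
Proof.
move=> od od' /in_slab[xX [dx xd]] /in_slab[_ [d'x xd']].
have [[rd rd'] rx] := (orbit_r od, orbit_r od', g_r xX).
have rsd := sigma_r rd; have rsd' := sigma_r rd'.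
have [dd'|[//|d'd]] := L_total rd rd'.
  by case: (orbit_gap od od' dd'); apply: L_trans d'x xd.
by case: (orbit_gap od' od d'd); apply: L_trans dx xd'.
Qed.

Lemma slab_family : ~ Finite slab_index ->
  exists F, Denumerable F /\ Cellular T F /\ Locally_finite X T F.
Proof.
have Ds := slab_def; move=> infI; exists (imS slab_index slab).
have sub_r : Sub slab_index r by move=> d /in_slab_index[/orbit_r].
have inj_slab d d' : d ∈ slab_index -> d' ∈ slab_index -> slab d = slab d' -> d = d'.
  move=> /in_slab_index[od [x xd]] /in_slab_index[od' _] eq_s.
  by apply: (slab_disjoint od od' xd); rewrite -eq_s.
have denI : Denumerable slab_index.
  apply: (denumerable_order (order_sub sub_r orderL) _ infI) => d /sub_r rd.
  apply: (finite_sub (orbit_seg_finite rd)) => d'.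
  have Dd : Def1 (fun z => L z d) by definable.
  by rewrite !(in_sep _ _ Dd) => -[/in_slab_index[od' _] dd'].
split.
  apply/denumerableE; apply: equip_trans (iffLR (denumerableE _) denI).
  exact/equip_sym/equip_im.
split; [split; [|split] |].
- move=> A /(in_im _ _ Ds)[d [/sub_r rd ->]]; apply: g_open => //; exact: sigma_r.
- by move=> A /(in_im _ _ Ds)[d [/in_slab_index[_ ne_d] ->]].
- move=> A /(in_im _ _ Ds)[d [/in_slab_index[od _] ->]].
  move=> B /(in_im _ _ Ds)[d' [/in_slab_index[od' _] ->]] neq [x [xd xd']].
  by apply: neq; rewrite (slab_disjoint od od' xd xd').
- move=> x xX; have rx := g_r xX; have rt := tau_r rx; have rs := sigma_r rx.
  have DN : Def1 (fun z => L (tau (g x)) (g z) /\ L (g z) (sigma (g x))) by definable.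
  (* The neighbourhood is the preimage of the interval from [tau (g x)] to [sigma (g x)]. A slab of
     index [d] that meets it has [d] below [sigma (g x)], which leaves finitely many [d]. *)
  exists (sepS X (fun z => L (tau (g x)) (g z) /\ L (g z) (sigma (g x)))).
  set N := sepS _ _; split.
    split; first by move=> z; rewrite in_sep // => -[].
    exists N; split; first exact: g_open.
    split; last by move=> z.
    rewrite in_sep //; split=> //; split; last exact: sigma_gt.
    by rewrite -{2}(tauK rx); apply: sigma_gt.
  have DG : Def1 (fun A => Meets A N) by definable.
  exists (sepS (imS slab_index slab) (fun A => Meets A N)).
  split; first by move=> A; apply: in_sep.
  apply: finite_sub (finite_im Ds (orbit_seg_finite rs)) _ => A.
  rewrite in_sep // => -[/(in_im _ _ Ds)[d [/in_slab_index[od _] ->]]].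
  case=> z [/in_slab[zX [dz _]]]; rewrite in_sep // => -[_ [_ zs]].
  apply/in_im => //; exists d; split=> //; rewrite in_sep; last by definable.
  by split=> //; apply: L_trans dz zs => //; [apply: orbit_r od|apply: g_r].
Qed.

(** Let [b] bound the indices of occupied slabs. A value beyond [sigma b] lies in no slab, since a
    slab of index [d] ends at [sigma d]; [orbit_floor] leaves only the orbit. *)
Lemma finite_slab_index : Finite slab_index -> exists b, b ∈ r /\
  forall x, x ∈ X -> L c (g x) -> L (sigma b) (g x) -> g x ∈ orbit c.
Proof.
move=> finI; have sub_r : Sub slab_index r by move=> d /in_slab_index[/orbit_r].
have [b [rb ub_b]] : exists b, b ∈ r /\ forall d, d ∈ slab_index -> d = b \/ L d b.
  case: (classic (Nonempty slab_index)) => [neI|eI].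
    have [b [Ib ub_b]] := finite_max orderL finI sub_r neI.
    by exists b; split=> //; apply: sub_r.
  (* With no occupied slab any point is a bound, and [c] is at hand. *)
  by exists c; split=> // d Id; case: eI; exists d.
exists b; split=> // x xX cx bx; have rx := g_r xX; have rsb := sigma_r rb.
have [//|[d [od [dx xd]]]] := orbit_floor rx cx.
have rd := orbit_r od; have rsd := sigma_r rd; case: (L_irr rx).
have /ub_b[eq_db|db] : d ∈ slab_index.
- by apply/in_slab_index; split=> //; exists x; apply/in_slab.
- by apply: L_trans xd _ => //; rewrite eq_db.
- by apply: L_trans xd _ => //; apply: L_trans bx => //; apply: sigma_mono.
Qed.

End Orbit.

(** Applying [sigma] to the interleaving of [c0], [c1], [sigma c0] puts a point of the second orbit
    strictly between [d] and [sigma d], for each [d] in the first. If [d] were in the second orbit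
    as well, [orbit_gap] would exclude that point. *)
Lemma orbit_disjoint c0 c1 d : c0 ∈ r -> c1 ∈ r -> L c0 c1 -> L c1 (sigma c0) ->
  d ∈ orbit c0 -> ~ d ∈ orbit c1.
Proof.
move=> r0 r1 c01 c10 od0 od1; have Do := orbit_def.
have [d' [od' [dd' d'd]]] : exists d', d' ∈ orbit c1 /\ L d d' /\ L d' (sigma d).
  move: d od0 {od1}; apply: orbit_ind => //; first by definable.
    by exists c1; split=> //; apply: orbit_start.
  move=> d od [d' [od' [dd' d'd]]]; exists (sigma d'); split; first exact: orbit_step.
  have [rd rd'] := (orbit_r od, orbit_r od'); have rsd := sigma_r rd.
  by split; apply: sigma_mono.
by case: (orbit_gap r1 od1 od' dd' d'd).
Qed.

Lemma slab_family_exists c0 c1 : c0 ∈ r -> c1 ∈ r -> L c0 c1 -> L c1 (sigma c0) ->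
  exists F, Denumerable F /\ Cellular T F /\ Locally_finite X T F.
Proof.
move=> r0 r1 c01 c10.
case: (classic (Finite (slab_index c0))) => fin0; last exact: (slab_family r0).
case: (classic (Finite (slab_index c1))) => fin1; last exact: (slab_family r1).
have [b0 [rb0 orb0]] := finite_slab_index r0 fin0.
have [b1 [rb1 orb1]] := finite_slab_index r1 fin1.
(* A value of [g] beyond the maximum of these four points meets the conditions of [orb0] and [orb1]
   together, hence lies in both orbits. *)
pose a := adjS (adjS (adjS (adjS emptyS c0) c1) (sigma b0)) (sigma b1).
have in_a z : z ∈ a <-> z = c0 \/ z = c1 \/ z = sigma b0 \/ z = sigma b1.
  rewrite !in_adj; split; last by tauto.
  by case=> [[[[/in_empty|]|]|]|]; tauto.
have fin_a : Finite a by do 4 apply: finite_adj; apply: finite_empty.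
have sub_a : Sub a r by move=> z /in_a[->|[->|[->|->]]] //; apply: sigma_r.
have [|m [ma max_m]] := finite_max orderL fin_a sub_a; first by exists c0; apply/in_a; left.
have rm := sub_a m ma; have [x [xX mx]] := g_unbounded rm; have rx := g_r xX.
have a_lt z : z ∈ a -> L z (g x).
  by move=> za; case: (max_m z za) => [->//|zm]; apply: L_trans zm mx => //; apply: sub_a.
case: (orbit_disjoint r0 r1 c01 c10 (d := g x)).
  by apply: orb0 => //; apply: a_lt; apply/in_a; tauto.
by apply: orb1 => //; apply: a_lt; apply/in_a; tauto.
Qed.

End Slabs.

(** ** Unbounded continuous real functions *)

Section Line.

Variables r add lt zero f : M.
Hypotheses (r0 : zero ∈ r) (add_op : Is_binop add r).
Hypotheses (addA : Op_assoc add) (addC : Op_comm add) (add0 : Op_unit r add zero).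
Hypothesis total_lt : Is_strict_total_order r lt.
Hypothesis lt_add : forall x y z xz yz,
  Opair_in x y lt /\ Op add x z xz /\ Op add y z yz -> Opair_in xz yz lt.
Hypothesis complete_lt : Dedekind_complete r lt.

Let lt_rel (x y : M) : Prop := Opair_in x y lt.
Definition addf (x y : M) : M := appS add r (opairS x y).
Local Notation "x ⊕ y" := (addf x y) (at level 50, left associativity).

Lemma opE h x y z : Op h x y z <-> opairS (opairS x y) z ∈ h.
Proof.
split=> [[p [/is_opairE-> /opair_inE]]//|xyz].
by exists (opairS x y); split; [apply/is_opairE|apply/opair_inE].
Qed.

Lemma addfP x y : x ∈ r -> y ∈ r ->
  x ⊕ y ∈ r /\ forall z, Op add x y z <-> z = x ⊕ y.
Proof.
have [c [prod_c fun_add]] := add_op => rx ry.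
have /(appP fun_add)[rxy xyE] : opairS x y ∈ c.
  by apply/prod_c; exists x; split=> //; exists y; split=> //; apply/is_opairE.
by split=> // z; rewrite opE.
Qed.

Lemma addf_r x y : x ∈ r -> y ∈ r -> x ⊕ y ∈ r.
Proof. by move=> rx ry; case: (addfP rx ry). Qed.

Lemma addfE x y z : x ∈ r -> y ∈ r -> Op add x y z <-> z = x ⊕ y.
Proof. by move=> rx ry; case: (addfP rx ry) => _; apply. Qed.

Lemma addfC x y : x ∈ r -> y ∈ r -> x ⊕ y = y ⊕ x.
Proof. by move=> rx ry; apply/(addfE _ ry rx)/addC/addfE. Qed.

Lemma addfA x y z : x ∈ r -> y ∈ r -> z ∈ r -> x ⊕ y ⊕ z = x ⊕ (y ⊕ z).
Proof.
move=> rx ry rz; have rxy := addf_r rx ry; have ryz := addf_r ry rz.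
apply/(addfE _ rx ryz); apply: (addA (y := y) (z := z) (xy := x ⊕ y)).
by split; [apply/addfE|split; apply/addfE].
Qed.

Lemma addf0 x : x ∈ r -> x ⊕ zero = x.
Proof.
by move=> rx; rewrite addfC //; apply/esym/addfE => //; apply: addC; case: add0 => _; apply.
Qed.

Lemma add0f x : x ∈ r -> zero ⊕ x = x.
Proof. by move=> rx; rewrite addfC // addf0. Qed.

Lemma lt_r x y : lt_rel x y -> x ∈ r /\ y ∈ r.
Proof.
have [rel_lt _] := total_lt => /opair_inE/rel_lt[x' [rx [y' [ry /is_opairE/opair_inj[-> ->]]]]].
by [].
Qed.

Lemma lt_order : Order lt_rel r.
Proof.
have [_ [irr [tr tot]]] := total_lt; split=> [|x _|x y z _ _ _ xy yz|x y rx ry].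
- by rewrite /lt_rel; definable.
- exact: irr.
- by apply: (tr x y z); split.
- exact: tot.
Qed.

Lemma addf_mono x y z : x ∈ r -> y ∈ r -> z ∈ r -> lt_rel x y -> lt_rel (x ⊕ z) (y ⊕ z).
Proof. by move=> rx ry rz xy; apply: (@lt_add x y z); split=> //; split; apply/addfE. Qed.

Lemma lt_sup s : Sub s r -> Nonempty s ->
  (exists b, b ∈ r /\ forall x, x ∈ s -> lt_rel x b \/ x = b) ->
  exists b, b ∈ r /\ (forall x, x ∈ s -> lt_rel x b \/ x = b) /\
    forall c, c ∈ r -> (forall x, x ∈ s -> lt_rel x c \/ x = c) -> lt_rel b c \/ b = c.
Proof. by move=> sr s0 bs; apply: complete_lt. Qed.

(** The infimum is the supremum of the set of lower bounds. This is completeness of the converse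
    order, needed when [f] is unbounded below. *)
Lemma lt_inf s : Sub s r -> Nonempty s ->
  (exists b, b ∈ r /\ forall x, x ∈ s -> lt_rel b x \/ x = b) ->
  exists b, b ∈ r /\ (forall x, x ∈ s -> lt_rel b x \/ x = b) /\
    forall c, c ∈ r -> (forall x, x ∈ s -> lt_rel c x \/ x = c) -> lt_rel c b \/ b = c.
Proof.
move=> sr [x0 sx0] [b0 [rb0 lb0]].
have Dl : Def1 (fun c => forall x, x ∈ s -> lt_rel c x \/ x = c).
  by rewrite /lt_rel; definable.
have [|||b [rb [ub_b lub_b]]] :=
    @lt_sup (sepS r (fun c => forall x, x ∈ s -> lt_rel c x \/ x = c)).
- by move=> c; rewrite in_sep // => -[].
- by exists b0; rewrite in_sep.
- exists x0; split; first exact: sr.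
  by move=> c; rewrite in_sep // => -[_ /(_ _ sx0)[|->]]; [left|right].
exists b; split=> //; split=> [x sx|c rc lc].
  have [c||->] := lub_b x (sr x sx); [|by left|by right].
  by rewrite in_sep // => -[_ /(_ _ sx)[|->]]; [left|right].
by have [|cb|->] := ub_b c; [rewrite in_sep|left|right].
Qed.

(** * Translations of the line as instances of the abstract setting *)

Section Translation.

Variables (X T : M) (L : M -> M -> Prop) (g : M -> M) (q q' : M).
Hypotheses (Dg : Fun_def g) (orderL : Order L r).
Hypotheses (rq : q ∈ r) (rq' : q' ∈ r) (qq' : q ⊕ q' = zero) (L0q : L zero q).
Hypothesis L_mono : forall x y z, x ∈ r -> y ∈ r -> z ∈ r -> L x y -> L (x ⊕ z) (y ⊕ z).
Hypothesis L_complete : forall s, Sub s r -> Nonempty s ->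
  (exists b, b ∈ r /\ forall x, x ∈ s -> L x b \/ x = b) ->
  exists b, b ∈ r /\ (forall x, x ∈ s -> L x b \/ x = b) /\
    forall c, c ∈ r -> (forall x, x ∈ s -> L x c \/ x = c) -> L b c \/ b = c.
Hypothesis g_r : forall x, x ∈ X -> g x ∈ r.
Hypothesis g_open : forall a b, a ∈ r -> b ∈ r ->
  sepS X (fun x => L a (g x) /\ L (g x) b) ∈ T.
Hypothesis g_unbounded : forall b, b ∈ r -> exists x, x ∈ X /\ L b (g x).

Lemma translation_family :
  exists F, Denumerable F /\ Cellular T F /\ Locally_finite X T F.
Proof.
have rqq : q ⊕ q ∈ r by apply: addf_r.
have rqq' : q' ⊕ q' ∈ r by apply: addf_r.
have Lqq : L q (q ⊕ q) by rewrite -{1}(add0f rq); apply: L_mono.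
have L0qq : L zero (q ⊕ q) by case: orderL => _ _ tr _; apply: tr L0q Lqq.
(* [tau] is translation by [q'] twice, where [q'] is the opposite of [q]. The starting points
   interleave because [q] lies strictly between zero and [q ⊕ q]. *)
apply: (slab_family_exists (r := r) (L := L) (sigma := fun x => x ⊕ (q ⊕ q))
          (tau := fun x => x ⊕ (q' ⊕ q')) (g := g) orderL _ _ _ _ _ _ _ L_complete
          g_r g_open g_unbounded (c0 := zero) (c1 := q)) => //.
- by rewrite /addf /appS /theS; definable.
- by move=> x rx; apply: addf_r.
- by move=> x rx; apply: addf_r.
- move=> x rx; have q'q : q' ⊕ q = zero by rewrite addfC.
  by rewrite addfA // (addfA rq' rq' rqq) -(addfA rq' rq rq) q'q add0f // q'q addf0.
- by move=> x y rx ry; apply: L_mono.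
- by move=> x rx; rewrite -{1}(add0f rx) (addfC rx) //; apply: L_mono.
- by rewrite add0f.
Qed.

End Translation.

Variables (X T one : M).
Hypotheses (r1 : one ∈ r) (one_neq0 : ~ zero = one).
Hypothesis addN : forall x, x ∈ r -> exists y, y ∈ r /\ Op add x y zero.
Hypothesis cont_f : Continuous_to_reals X T r lt f.
Hypothesis unbounded_f : ~ Bounded_fun r lt f.

Let g (x : M) : M := appS f r x.

Lemma graph_f x y : Opair_in x y f <-> x ∈ X /\ y = g x.
Proof.
have [fun_f _] := cont_f; rewrite opair_inE; split=> [xyf|[xX ->]].
  have [x' [xX [y' [_ /is_opairE/opair_inj[xx' _]]]]] := fun_f.1 _ xyf.
  by rewrite -xx' in xX; have [_ fx] := appP fun_f xX; split=> //; apply/fx.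
by have [_ fx] := appP fun_f xX; apply/fx.
Qed.

Lemma value_r x : x ∈ X -> g x ∈ r.
Proof. by have [fun_f _] := cont_f => /(appP fun_f)[]. Qed.

Lemma preimage_interval a b : a ∈ r -> b ∈ r ->
  sepS X (fun x => lt_rel a (g x) /\ lt_rel (g x) b) ∈ T.
Proof.
have Dg : Fun_def g by apply: app_def.
have Dlt : Rel_def lt_rel by case: lt_order.
move=> ra rb; have [_ /(_ (sepS r (fun y => lt_rel a y /\ lt_rel y b)))[|U [UT defU]]] := cont_f.
  split=> [y|y]; rewrite in_sep; [by case|by definable| |by definable].
  move=> [ry [ay yb]]; exists a, b; split=> //; split=> // z [az zb].
  by rewrite in_sep; [split=> //; case: (lt_r az)|definable].
suff <- : U = sepS X (fun x => lt_rel a (g x) /\ lt_rel (g x) b) by [].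
have Di : Def1 (fun x => lt_rel a (g x) /\ lt_rel (g x) b) by definable.
have Dj : Def1 (fun y => lt_rel a y /\ lt_rel y b) by definable.
apply: ext => x; rewrite defU (in_sep _ _ Di).
split=> [[y []]|[xX axb]].
  by rewrite (in_sep _ _ Dj) => -[ry ayb] /graph_f[xX yx]; rewrite yx in ayb.
exists (g x); rewrite (in_sep _ _ Dj) graph_f; split=> //; split=> //; exact: value_r.
Qed.

Lemma unbounded_family :
  exists F, Denumerable F /\ Cellular T F /\ Locally_finite X T F.
Proof.
have Dg : Fun_def g by apply: app_def.
have [q [q' [rq [rq' [qq' q_gt0]]]]] : exists q q', q ∈ r /\ q' ∈ r /\
    q ⊕ q' = zero /\ lt_rel zero q.
  (* [y] is the opposite of one. Trichotomy decides which of the two is positive and is taken as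
     [q]; if one is negative, adding [y] to both sides shows that [y] is positive. *)
  have [y [ry /addfE]] := addN r1 => /(_ r1 ry)/esym one_y.
  have [_ _ _ /(_ _ _ r0 r1)[lt01|[//|lt10]]] := lt_order; first by exists one, y.
  exists y, one; do 3 split=> //; first by rewrite addfC.
  by have := addf_mono r1 r0 ry lt10; rewrite one_y add0f.
case: (classic (forall b, b ∈ r -> exists x, x ∈ X /\ lt_rel b (g x))) => [ub|no_ub].
  apply: (translation_family Dg lt_order rq rq' qq' q_gt0 addf_mono lt_sup value_r) => //.
  exact: preimage_interval.
case: (classic (forall b, b ∈ r -> exists x, x ∈ X /\ lt_rel (g x) b)) => [lb|no_lb].
  have q'q : q' ⊕ q = zero by rewrite addfC.
  apply: (translation_family Dg (order_flip lt_order) rq' rq q'q _ _ lt_inf value_r) => //.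
  - by have := addf_mono r0 rq rq' q_gt0; rewrite add0f // qq'.
  - by move=> x y z rx ry rz; apply: addf_mono.
  - move=> a b ra rb.
    suff -> : sepS X (fun x => lt_rel (g x) a /\ lt_rel b (g x)) =
              sepS X (fun x => lt_rel b (g x) /\ lt_rel (g x) a).
      exact: preimage_interval.
    by congr sepS; apply: functional_extensionality => x;
      apply: propositional_extensionality; tauto.
case: unbounded_f.
have [_ _ _ tot] := lt_order.
have {no_ub}[b [rb ub]] : exists b, b ∈ r /\ forall x, x ∈ X -> ~ lt_rel b (g x).
  apply: NNPP => no_b; apply: no_ub => b rb; apply: NNPP => no_x.
  by apply: no_b; exists b; split=> // x xX bx; apply: no_x; exists x.
have {no_lb}[a [ra lb]] : exists a, a ∈ r /\ forall x, x ∈ X -> ~ lt_rel (g x) a.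
  apply: NNPP => no_b; apply: no_lb => a ra; apply: NNPP => no_x.
  by apply: no_b; exists a; split=> // x xX ax; apply: no_x; exists x.
exists a; split=> //; exists b; split=> // x y /graph_f[xX ->].
have rx := value_r xX; split.
  by have [ax|[ax|/lb//]] := tot a (g x) ra rx; [left|right].
by have [xb|[xb|/ub//]] := tot (g x) b rx rb; [left|right].
Qed.

End Line.

Lemma not_pseudocompact_family X T : ~ Pseudocompact X T ->
  exists F, Denumerable F /\ Cellular T F /\ Locally_finite X T F.
Proof.
move=> not_pc; apply: NNPP => no_F; apply: not_pc => r add mul zero one lt.
case=> [[add_op [addA [addC [add0 [addN [_ [_ [_ [mul1 [_ [neq01 _]]]]]]]]]]]].
case=> [total_lt [lt_add [_ complete_lt]]] f cont_f; apply: NNPP => unb_f; apply: no_F.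
exact: (unbounded_family add0.1 add_op addA addC add0 total_lt lt_add complete_lt
          mul1.1 neq01 addN cont_f unb_f).
Qed.

End Model.

Theorem proposition2p22 :
  provable ZF (sentence (
    ∀ X, ∀ T, is_topology X T ∧ ¬ pseudocompact X T ⇒
      (∃ F, denumerable F ∧ cellular T F ∧ locally_finite X T F) ∧
      ¬ B1 X T ∧ ¬ B2 X T ∧ ¬ B3 X T ∧ ¬ B4 X T ∧ ¬ B5 X T)%zf).
Proof.
apply: completeness; [exact: ZF_closed|by []|].
move=> M E rho0 model0.
have model rho B : ZF B -> sat E rho B.
  by move=> ZB; apply/(sat_closed E rho rho0 (ZF_closed ZB)); apply: model0.
suff main X T : Is_topology E X T /\ ~ Pseudocompact E X T ->
    (exists F, Denumerable E F /\ Cellular E T F /\ Locally_finite E X T F) /\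
    ~ SB1 E X T /\ ~ SB2 E X T /\ ~ SB3 E X T /\ ~ SB4 E X T /\ ~ SB5 E X T.
  (* Satisfaction of the sentence in the model computes to the statement of [main]. *)
  exact: main.
move=> [top not_pc].
have [F famF] := not_pseudocompact_family model (rho0 0) not_pc.
split; first by exists F.
by case: famF => denF [cellF lfF]; apply: (locally_finite_notB model (rho0 0) top denF cellF lfF).
Qed.
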